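(* Let $G$ be a finite group, $B$ a block of $\mathcal{O}G$, $D$ a defect group of $B$, and $i\in B^D$ a source idempotent. Set $A=iBi$. Let $\chi\in\mathrm{Irr}(B)$. (i) Let $Q$ be a $p$-subgroup of $G$ such that $(Be_\chi)(Q)\neq\{0\}$. Then there is $x\in G$ such that ${}^xQ\leq D$ and such that $(Ae_\chi)({}^xQ)\neq\{0\}$. (ii) Let $Q$ be a subgroup of $D$ of maximal order subject to $(Ae_\chi)(Q)\neq\{0\}$. Then $Q$ is an anchor of $\chi$.
   Context: $p$ is a prime, $\mathcal{O}$ is a complete discrete valuation ring with residue field $k=\mathcal{O}/J(\mathcal{O})$ of characteristic $p$ and field of fractions $K$ of characteristic $0$; $K$ and $k$ are assumed to be splitting fields for all finite groups under consideration. $\mathrm{Irr}(G)$ is the set of characters of simple $KG$-modules; $\mathrm{Irr}(B)$ is the set of $\chi\in\mathrm{Irr}(G)$ with $\chi(1_B)=\chi(1)$. $e_\chi$ is the unique primitive idempotent in $Z(KG)$ with $\chi(e_\chi)\neq 0$. $G$ acts by conjugation on the $\mathcal{O}$-order $\mathcal{O}Ge_\chi=Be_\chi\subseteq KGe_\chi$. For an $\mathcal{O}$-algebra $C$ with an action of a group containing $P\geq Q$, $C^P$ denotes the $P$-fixed points and $\mathrm{Tr}_Q^P:C^Q\to C^P$, $a\mapsto\sum_{x\in P/Q}{}^xa$, the relative trace map. An anchor of $\chi$ is a subgroup $P$ of $G$ minimal subject to $e_\chi\in \mathrm{Tr}_P^G((\mathcal{O}Ge_\chi)^P)$; the anchors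 form one $G$-conjugacy class of $p$-subgroups. For a $p$-group $Q$ acting on an $\mathcal{O}$-algebra $C$, the Brauer quotient is $C(Q)=C^Q/\bigl(\sum_{R<Q}\mathrm{Tr}_R^Q(C^R)+J(\mathcal{O})C^Q\bigr)$, with canonical map $\mathrm{Br}_Q:C^Q\to C(Q)$. A source idempotent is a primitive idempotent $i$ of $B^D$ with $\mathrm{Br}_D(i)\neq 0$. The algebra $Ae_\chi=ie_\chi\,\mathcal{O}G\,ie_\chi$ has unit $ie_\chi$ and is a $D$-interior algebra via $u\mapsto uie_\chi$; $D$ and its subgroups act on it by conjugation. ${}^xQ=xQx^{-1}$. *)

(* Defs.v *)
From HB Require Import structures.
From mathcomp Require Import all_boot all_order all_algebra.
From mathcomp Require Import all_fingroup all_solvable all_field all_character.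
From mathcomp Require Import boolp classical_sets.

Set Implicit Arguments.
Unset Strict Implicit.
Unset Printing Implicit Defensive.

Import GRing.Theory.

Local Open Scope classical_set_scope.
Local Open Scope group_scope.
Local Open Scope ring_scope.

Definition add_span (V : nmodType) (S : set V) : set V :=
  [set v | exists s : seq V, (forall x, x \in s -> S x) /\ v = \sum_(x <- s) x].

Section CompleteDVR.
Variable O : idomainType.

Definition is_ideal (I : set O) : Prop :=
  [/\ I 0, forall x y, I x -> I y -> I (x + y) & forall r x, I x -> I (r * x)].

(* For a local ring the Jacobson radical J(O) is the set of nonunits. *)
Definition max_ideal : set O := [set x | x \isn't a GRing.unit].

Definition is_local : Prop := is_ideal max_ideal.

Definition is_pid : Prop :=
  forall I, is_ideal I -> exists a, I = [set r * a | r in [set: O]].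

Definition is_dvr : Prop :=
  [/\ is_pid, is_local & exists x, max_ideal x /\ x <> 0].

Fixpoint max_ideal_pow (n : nat) : set O :=
  if n is m.+1 then
    add_span [set z | exists x y,
      [/\ max_ideal x, max_ideal_pow m y & z = x * y]]
  else [set: O].

Definition adic_complete : Prop :=
  forall u : nat -> O,
    (forall n, exists N, forall i j, (N <= i)%N -> (N <= j)%N ->
       max_ideal_pow n (u i - u j)) ->
    exists l, forall n, exists N, forall i, (N <= i)%N ->
       max_ideal_pow n (u i - l).

Definition complete_dvr : Prop := is_dvr /\ adic_complete.

(* red exhibits k as the residue field O / J(O). *)
Definition is_residue_map (k : fieldType) (red : {rmorphism O -> k}) : Prop :=
  (forall y, exists x, red x = y) /\ (forall x, red x = 0 <-> max_ideal x).

End CompleteDVR.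

Definition splits_subgroups (F : fieldType) (gT : finGroupType)
    (G : {group gT}) : Prop :=
  forall H : {group gT}, H \subset G -> group_splitting_field F H.

(* KG is the library's group_ring, the subalgebra of 'M[K]_#|G| spanned by
   the matrices regular_repr K G x for x in G.  Every O-algebra below (OG, its
   blocks, OGe, iBi, iBie) is a subset of KG, and may have as its identity
   element an idempotent other than 1. *)
Section GroupAlgebra.
Variables (O : idomainType) (gT : finGroupType) (G : {group gT}).
Let K := {fraction O}.
Let M := 'M[K]_#|G|.
Implicit Types (C : set M) (P Q R : {group gT}) (a b e i : M) (x : gT).

Definition gelt x : M := regular_repr K G x.

Definition KG : set M := [set a | (a \in group_ring K G)%MS].

Definition OG : set M :=
  [set \sum_(x in G) tofrac (f x) *: gelt x | f in [set: gT -> O]].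

Definition center_of C : set M :=
  [set z | C z /\ forall a, C a -> z *m a = a *m z].

Definition primitive_idem C i : Prop :=
  [/\ C i, i *m i = i, i <> 0 &
      forall j l, C j -> C l -> j *m j = j -> l *m l = l ->
        j *m l = 0 -> l *m j = 0 -> i = j + l -> j = 0 \/ l = 0].

(* ^x a = x a x^-1, whereas the library's x ^ y is y^-1 x y; accordingly
   ^x Q is Q :^ x^-1. *)
Definition conj_by x a : M := gelt x *m a *m gelt x^-1%g.

Definition fixed C P : set M :=
  [set a | C a /\ forall x, x \in P -> conj_by x a = a].

(* Tr_Q^P; on Q-fixed elements the value does not depend on the choice of
   coset representatives made by repr. *)
Definition rel_trace Q P a : M :=
  \sum_(X in lcosets Q P) conj_by (repr X) a.

Definition brauer_ker C Q : set M :=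
  add_span
    ([set c | exists R a, [/\ R \proper Q, fixed C R a & c = rel_trace R Q a]]
     `|` [set c | exists r a,
            [/\ max_ideal r, fixed C Q a & c = tofrac (r : O) *: a]]).

(* C(Q) as a set of cosets, and the canonical map Br_Q : C^Q -> C(Q). *)
Definition brauer_map C Q a : set M := [set a + c | c in brauer_ker C Q].

Definition brauer_quotient C Q : set (set M) := brauer_map C Q @` fixed C Q.

Definition brauer_nonzero C Q : Prop :=
  brauer_quotient C Q <> [set brauer_map C Q 0].

(* P is minimal among the subgroups of G such that u is in Tr_P^G(C^P). *)
Definition trace_minimal C (u : M) P : Prop :=
  [/\ P \subset G, (rel_trace P G @` fixed C P) u &
      forall R, R \proper P -> ~ (rel_trace R G @` fixed C R) u].

Definition is_block_idem b : Prop := primitive_idem (center_of OG) b.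

Definition OG_cut e : set M := [set a *m e | a in OG].

Definition defect_group b P : Prop := trace_minimal (OG_cut b) b P.

Definition source_idem b (D : {group gT}) i : Prop :=
  let B := OG_cut b in
  primitive_idem (fixed B D) i /\ brauer_map B D i <> brauer_map B D 0.

(* Characters are regarded as functions on KG; gring_op rG is the linear
   extension of rG to KG. *)
Definition irr_char (chi : M -> K) : Prop :=
  exists (n : nat) (rG : mx_representation K G n),
    mx_irreducible rG /\ chi = fun a => \tr (gring_op rG a).

Definition irr_block b (chi : M -> K) : Prop :=
  irr_char chi /\ chi b = chi 1%:M.

(* e = e_chi *)
Definition char_idem (chi : M -> K) e : Prop :=
  primitive_idem (center_of KG) e /\ chi e <> 0.

(* P is an anchor of chi, where e = e_chi. *)
Definition anchor e P : Prop := trace_minimal (OG_cut e) e P.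

(* B e_chi *)
Definition block_cut b e : set M := [set a *m e | a in OG_cut b].

(* A = iBi and A e_chi.  Since D commutes with i and e_chi, conjugation by
   u i e_chi in A e_chi is the restriction of conj_by u, for u in D. *)
Definition source_alg b i : set M := [set i *m a *m i | a in OG_cut b].

Definition source_cut b i e : set M := [set a *m e | a in source_alg b i].

End GroupAlgebra.

(* Main.v *)
(* The block idempotent b lies in Tr_D^G(B^D i B^D). Indeed, by locality of
   Z(B), b = Tr_D^G(c j) with j a primitive idempotent of B^D; expanding
   i = i b i by Mackey's formula in the local ring i B^D i, and using
   Br_D(i) <> 0, some conjugate of j lies in B^D i B^D. Multiplying by e = e_chi
   and applying Mackey's formula again, (B e)(Q) <> 0 forces a conjugate Q' of Q
   to lie in D with Br_Q'(i e) <> 0, which is (i). For (ii), if P is minimal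
   with e in Tr_P^G((OGe)^P), then (OGe)(P) <> 0 as (OGe)^G is local, so (i)
   bounds |P| by |Q|; conversely Mackey's formula puts Q inside a conjugate of P.

   Locality of an O-order without nontrivial idempotents is obtained from
   completeness of O alone: each element is a root of a monic polynomial f over
   O, and the Fitting idempotent of X modulo (pi, f) lifts to O[X]/(f). *)

Require Import Defs.
From HB Require Import structures.
From mathcomp Require Import all_boot all_order all_algebra.
From mathcomp Require Import all_fingroup all_solvable all_field all_character.
From mathcomp Require Import boolp classical_sets.
From mathcomp Require Import ring.

Set Implicit Arguments.
Unset Strict Implicit.
Unset Printing Implicit Defensive.

From mathcomp.boot Require Import fintype finset.
Import GRing.Theory.

Local Open Scope group_scope.
Local Open Scope ring_scope.

(** * Lifting idempotents over a complete discrete valuation ring *)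

Section Uniformizer.
Variable O : idomainType.

(** Krull-Schmidt and Rosenberg's lemma are replaced by one statement: in an order over O without
    nontrivial idempotents, a sum that is a unit has a unit among its terms. It concerns one element
    a at a time, so the only ring to be understood is O[X]/(f), with f the characteristic polynomial
    of an integral matrix that acts as a on the identity of the order. This is why integrality is
    carried along even for OGe_chi, whose identity need not have entries in O. Primitivity of i is
    exploited inside B^D, before multiplication by e_chi, because (Be_chi)^D may be larger than the
    image of B^D. The factorization of b through i then passes to Be_chi without any lifting of
    idempotents. Since K has characteristic 0, a relative trace is an average over a full group, and
    the identities for traces reduce to reindexing of sums. *)

Lemma dvr_uniformizer : is_dvr O ->
  exists pi : O, forall x : O, max_ideal x <-> exists r, x = r * pi.
Proof.
move=> [pid loc _]; have [pi Epi] := pid _ loc.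
exists pi => x; rewrite Epi; split=> [[r _ <-] | [r ->]]; first by exists r.
by exists r.
Qed.

Variables (pi : O) (piP : forall x : O, max_ideal x <-> exists r, x = r * pi).

Lemma uniformizer_nonunit : pi \isn't a GRing.unit.
Proof. by apply: (piP pi).2; exists 1; rewrite mul1r. Qed.

Lemma uniformizer_neq0 : is_dvr O -> pi != 0.
Proof.
move=> [_ _ [x [/piP[r ->] nz]]]; apply/eqP=> pi0.
by apply: nz; rewrite pi0 mulr0.
Qed.

Lemma unit_add_uniformizer (u r : O) : is_dvr O ->
  u \is a GRing.unit -> u + r * pi \is a GRing.unit.
Proof.
move=> [_ [_ addM mulM] _] Uu; apply/negP=> /negP nU.
have /negP[] : max_ideal u; last by [].
rewrite -[u](addrK (r * pi)); apply: addM => //.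
by rewrite -mulN1r mulrA; apply: (piP _).2; exists (-1 * r).
Qed.

Lemma max_ideal_powP n (x : O) :
  max_ideal_pow n x <-> exists r, x = r * pi ^+ n.
Proof.
elim: n x => [|n IHn] x /=.
  by split=> // _; exists x; rewrite expr0 mulr1.
split=> [[s [sP ->]] | [r ->]].
  elim: s sP => [|y s IHs] sP; first by exists 0; rewrite big_nil mul0r.
  rewrite big_cons; have [|r ->] := IHs.
    by move=> z sz; apply: sP; rewrite inE sz orbT.
  have [|y1 [y2 [/piP[r1 ->] /IHn[r2 ->] ->]]] := sP y; first exact: mem_head.
  by exists (r1 * r2 + r); rewrite exprS; ring.
exists [:: pi * (r * pi ^+ n)]; split; last by rewrite big_seq1 exprS; ring.
move=> y; rewrite inE => /eqP->; exists pi, (r * pi ^+ n); split=> //.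
  exact: uniformizer_nonunit.
by apply/IHn; exists r.
Qed.

(** The union of the ideals (x : pi^n) is principal, so its generator a satisfies a pi^N = r x for
    some N. Writing x = t pi^(N+1) puts t in this union, t = s a, whence x = x s r pi; a nonzero x
    would make pi a unit. *)
Lemma uniformizer_separated (x : O) : is_dvr O ->
  (forall n, exists r, x = r * pi ^+ n) -> x = 0.
Proof.
move=> dvrO xP; apply/eqP/negPn/negP => nzx.
have [pid _ _] := dvrO; have nzpi := uniformizer_neq0 dvrO.
pose I := [set y : O | exists n r, y * pi ^+ n = r * x]%classic.
have idI : is_ideal I.
  split=> [|y z [n1 [r1 E1]] [n2 [r2 E2]] |r y [n [s E]]].
  - by exists 0%N, 0; rewrite !mul0r.
  - exists (n1 + n2)%N, (r1 * pi ^+ n2 + r2 * pi ^+ n1); rewrite exprD.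
    transitivity (y * pi ^+ n1 * pi ^+ n2 + z * pi ^+ n2 * pi ^+ n1); first ring.
    by rewrite E1 E2; ring.
  - by exists n, (r * s); rewrite -mulrA E mulrA.
have [a Ia] := pid I idI.
have [N [r Ea]] : I a by rewrite Ia; exists 1 => //; rewrite mul1r.
have [t Et] := xP N.+1.
have : I t by exists N.+1, 1; rewrite mul1r -Et.
rewrite Ia => -[s _ Es].
have Ex : x = x * (s * r * pi).
  rewrite {1}Et exprS -Es; transitivity (s * (a * pi ^+ N) * pi); first ring.
  rewrite Ea; ring.
have : x * (1 - s * r * pi) = 0 by rewrite mulrBr mulr1 -Ex subrr.
move/eqP; rewrite mulf_eq0 (negPf nzx) subr_eq0 /= => /eqP E1.
have := uniformizer_nonunit; rewrite -unitrN; case/negP.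
by rewrite unitrN; apply/unitrPr; exists (s * r); rewrite mulrC.
Qed.

(** The limit comes with an explicit rate: consecutive differences divisible by pi^n make all later
    differences divisible by pi^n, so the limit can be compared with u n through one sufficiently
    late term. *)
Lemma uniformizer_complete (u : nat -> O) : adic_complete O ->
  (forall n, exists r, u n.+1 - u n = r * pi ^+ n) ->
  exists l, forall n, exists r, l - u n = r * pi ^+ n.
Proof.
move=> compO stepu.
have du n m : (n <= m)%N -> exists r, u m - u n = r * pi ^+ n.
  move=> /subnKC <-; elim: (m - n)%N => [|d [r Er]].
    by exists 0; rewrite addn0 subrr mul0r.
  have [s Es] := stepu (n + d)%N.
  exists (s * pi ^+ d + r); rewrite addnS.
  rewrite -[u (n + d).+1](subrK (u (n + d)%N)) -addrA Er Es exprD; ring.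
have [|l lP] := compO u.
  move=> n; exists n => i j ni nj; apply/max_ideal_powP.
  have [[r Er] [s Es]] := (du _ _ ni, du _ _ nj).
  exists (r - s); rewrite mulrBl -Er -Es; ring.
exists l => n; have [N NP] := lP n.
have /max_ideal_powP[r Er] := NP (maxn N n) (leq_maxl _ _).
have [s Es] := du n (maxn N n) (leq_maxr _ _).
exists (s - r); rewrite mulrBl -Er -Es; ring.
Qed.

End Uniformizer.

(** * Newton iteration and the Fitting idempotent in O[X]/(f) *)

Section IdempotentLifting.
Import Pdiv.Ring Pdiv.RingMonic.
Variables (O : idomainType) (hO : complete_dvr O).
Variables (pi : O) (piP : forall x : O, max_ideal x <-> exists r, x = r * pi).

Let dvrO : is_dvr O := hO.1.

(** Newton's method for Y^2 - Y: the derivative 2h - 1 is its own inverse modulo h^2 - h. The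
    correction is reduced modulo f, so that sizes stay below N throughout the iteration and
    coefficientwise limits remain polynomials. *)
Lemma newton_idem_step (f h : {poly O}) (N n : nat) : f \is monic ->
  (size f <= N)%N -> (size h <= N)%N ->
  (exists q r, h ^+ 2 - h = q * f + pi ^+ n.+1 *: r) ->
  exists h' : {poly O}, [/\ (size h' <= N)%N,
    exists r, h' - h = pi ^+ n.+1 *: r &
    exists q r, h' ^+ 2 - h' = q * f + pi ^+ n.+2 *: r].
Proof.
move=> monf szf szh [q [r Er]].
pose z := r * (h *+ 2 - 1); pose s := rmodp z f.
have Ez : z = rdivp z f * f + s := rdivp_eq monf z.
exists (h - pi ^+ n.+1 *: s); split.
- apply: leq_trans (size_polyD _ _) _; rewrite geq_max szh size_polyN.
  apply: leq_trans (size_scale_leq _ _) _.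
  by apply: leq_trans (ltnW (ltn_rmodpN0 _ _)) szf; apply: monic_neq0.
- by exists (- s); rewrite scalerN; ring.
pose y := h ^+ 2 - h.
have Es : s = z - rdivp z f * f by rewrite [X in X - _]Ez addrC addKr.
pose c : {poly O} := (pi ^+ n.+1)%:P.
have -> : pi ^+ n.+2 = pi * pi ^+ n.+1 by rewrite exprS.
(* (h - c s)^2 - (h - c s) = y - c s (2h - 1) + c^2 s^2 with s = r (2h - 1)
   mod f and (2h - 1)^2 = 1 + 4 y. *)
exists (q + c * rdivp z f * (h *+ 2 - 1) - c * r * q *+ 4).
exists (pi ^+ n *: (s ^+ 2 - r ^+ 2 *+ 4)).
rewrite -!mul_polyC -/c; have Epi : (pi * pi ^+ n.+1)%:P * (pi ^+ n)%:P = c ^+ 2.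
  by rewrite -polyCM -rmorphXn /=; congr _%:P; rewrite exprS; ring.
rewrite mulrA Epi.
transitivity (y - c * s * (h *+ 2 - 1) + c ^+ 2 * s ^+ 2); first by rewrite /y; ring.
rewrite [X in c * X]Es.
transitivity (y - c * r * (y *+ 4 + 1) + c * rdivp z f * f * (h *+ 2 - 1)
              + c ^+ 2 * s ^+ 2); first by rewrite /y /z; ring.
rewrite /y Er -mul_polyC -/c; ring.
Qed.

Lemma idem_lift (f h0 : {poly O}) : f \is monic ->
  (exists q r, h0 ^+ 2 - h0 = q * f + pi *: r) ->
  exists h : {poly O}, (exists q, h ^+ 2 - h = q * f) /\
    (exists r, h - h0 = pi *: r).
Proof.
move=> monf idh0; pose N := maxn (size f) (size h0).
have szf : (size f <= N)%N := leq_maxl _ _.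
pose P n (h : {poly O}) := (size h <= N)%N /\
  exists q r, h ^+ 2 - h = q * f + pi ^+ n.+1 *: r.
have step n h : {h' | P n h -> P n.+1 h' /\
   exists r, h' - h = pi ^+ n.+1 *: r}.
  apply: cid; have [[szh Ph]|nP] := pselect (P n h); last by exists h.
  have [h' [sz' d' P']] := newton_idem_step monf szf szh Ph.
  by exists h' => _; split.
pose H := fix H n := if n is m.+1 then sval (step m (H m)) else h0.
have PH n : P n (H n).
  elim: n => [|n IHn]; first by split; [apply: leq_maxr | rewrite expr1].
  by rewrite /=; case: (step n (H n)) => h' /= /(_ IHn)[].
have dH n : exists r, H n.+1 - H n = pi ^+ n.+1 *: r.
  by rewrite /=; case: (step n (H n)) => h' /= /(_ (PH n))[].
have /choice[c cP] j : exists l, forall n, exists r,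
    l - (H n)`_j = r * pi ^+ n.
  apply: (uniformizer_complete piP hO.2) => n; have [r Er] := dH n.
  by exists (r`_j * pi); rewrite -coefB Er coefZ exprS; ring.
(* Every [H n] has size at most N, so the limits of the first N coefficients determine the limit
   polynomial. *)
pose h := \poly_(j < N) c j.
have szh n : (size (h - H n)%R <= N)%N.
  apply: leq_trans (size_polyD _ _) _; rewrite geq_max size_polyN size_poly.
  by case: (PH n).
have dh n : exists r, h - H n = pi ^+ n *: r.
  have /choice[r rP] := fun j => cP j n.
  exists (\poly_(j < N) r j); apply/polyP=> j.
  rewrite coefZ coef_poly; case: ltnP => [ltjN|leNj].
    by rewrite coefB coef_poly ltjN rP mulrC.
  by rewrite mulr0 nth_default // (leq_trans (szh n)).
exists h; split.
  (* Division by the monic f is O-linear, so the remainder of h^2 - h is divisible by every pi^n and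
     vanishes by separatedness. *)
  exists (rdivp (h ^+ 2 - h) f); rewrite [LHS](rdivp_eq monf).
  suff -> : rmodp (h ^+ 2 - h) f = 0 by rewrite addr0.
  apply/polyP=> j; rewrite coef0; apply: (uniformizer_separated piP dvrO) => n.
  have [[r Er] [_ [q [s Es]]]] := (dh n, PH n).
  have Eh : h = H n + pi ^+ n *: r by rewrite -Er addrC subrK.
  pose c' := (pi ^+ n)%:P.
  have -> : h ^+ 2 - h = q * f + pi ^+ n *:
      (pi *: s + H n * r *+ 2 + pi ^+ n *: r ^+ 2 - r).
    transitivity (H n ^+ 2 - H n + c' * (H n * r *+ 2 + c' * r ^+ 2 - r)).
      rewrite Eh -mul_polyC -/c'; ring.
    rewrite Es -!mul_polyC -/c' exprS rmorphM /= -/c'; ring.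
  rewrite rmodpD // rmodp_mull // add0r rmodpZ // coefZ mulrC.
  by eexists.
have [r Er] := dh 1%N.
have [s Es] := dH 0%N.
exists (r + s); rewrite scalerDr -[pi](expr1 pi) -Er -Es /=; ring.
Qed.

Variables (k : fieldType) (red : {rmorphism O -> k}).
Hypothesis hred : is_residue_map red.

Lemma poly_red_eq0 (p : {poly O}) : map_poly red p = 0 -> exists r, p = pi *: r.
Proof.
move=> p0; have /choice[r rP] j : exists s, p`_j = s * pi.
  by apply/(piP _).1/(hred.2 _).1; rewrite -coef_map p0 coef0.
exists (\poly_(j < size p) r j); apply/polyP=> j.
rewrite coefZ coef_poly; case: ltnP => [_|lej]; first by rewrite rP mulrC.
by rewrite mulr0 nth_default.
Qed.

Lemma poly_red_surj (q : {poly k}) : exists p, map_poly red p = q.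
Proof.
have /choice[c cP] := hred.1.
exists (\poly_(j < size q) c q`_j); apply/polyP=> j.
rewrite coef_map coef_poly; case: ltnP => [_|lej]; first exact: cP.
by rewrite raddf0 nth_default.
Qed.

(* h is the idempotent of O[X]/(f) cutting out the factor on which X is
   invertible; on the complementary factor X is topologically nilpotent. *)
Lemma fitting_idem (f : {poly O}) : f \is monic ->
  exists h w1 w2 w3 w4 q r1 r2 : {poly O},
    [/\ h ^+ 2 - h = q * f, h = 'X * w1 + pi *: r1 &
        1 = (1 - 'X) * w2 + w3 * h + w4 * f + pi *: r2].
Proof.
(* The extra factor X forces the multiplicity m of the root 0 to be positive, so that X divides u
   X^m. *)
move=> monf; pose f1 := 'X * f; pose fb := map_poly red f1.
have nzfb : fb != 0 by rewrite monic_neq0 // monic_map // monicMl ?monicX.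
have [m [g ng0 Ef]] := multiplicity_XsubC fb 0.
rewrite nzfb /= subr0 in ng0 Ef.
have Efb : 'X * map_poly red f = g * 'X^m.
  by rewrite -Ef /fb /f1 rmorphM /= map_polyX.
have m_gt0 : (0 < m)%N.
  rewrite lt0n; apply/eqP=> m0; case/negP: ng0.
  by rewrite -[g]mulr1 -(expr0 'X) -m0 -Efb rootM rootX eqxx.
have cop : coprimep ('X^m) g.
  by rewrite coprimep_expl // coprimep_sym -['X]subr0 -polyC0 coprimep_XsubC.
have /Bezout_eq1_coprimepP[[ub vb] /= Euv] := cop.
have [[u Eu] [v Ev]] := (poly_red_surj ub, poly_red_surj vb).
(* Modulo pi one has u X^m + v g = 1 and X f = g X^m: thus h0 is 1 on the factor g, where X is
   invertible, and 0 on the factor X^m. *)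
pose h0 := u * 'X^m.
have [|r Er] := @poly_red_eq0 (h0 ^+ 2 - h0 + u * v * f1).
  rewrite !(rmorphD, rmorphN, rmorphM, rmorphXn) /= map_polyX Eu Ev Efb.
  have -> : (ub * 'X^m) ^+ 2 - ub * 'X^m + ub * vb * (g * 'X^m) =
    ub * 'X^m * (ub * 'X^m + vb * g - 1) by ring.
  by rewrite Euv subrr mulr0.
have [|h [[q Eq] [s Es]]] := @idem_lift f h0 monf.
  exists (- (u * v * 'X)), r; rewrite -Er /f1; ring.
have [|t Et] := @poly_red_eq0 ('X^m * (1 - h0) - v * f1).
  rewrite !(rmorphD, rmorphN, rmorphM, rmorphXn) /= rmorph1 map_polyX Eu Ev Efb.
  have -> : 'X^m * (1 - ub * 'X^m) - vb * (g * 'X^m) =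
    'X^m * (1 - (ub * 'X^m + vb * g)) by ring.
  by rewrite Euv subrr mulr0.
(* The geometric sum gives 1 - X^m, and X^m = X^m h0 + v X f + pi t, where h0 is replaced by h - pi
   s. *)
exists h, (u * 'X^(m.-1)), (\sum_(j < m) 'X^j), 'X^m, (v * 'X), q, s, (t - 'X^m * s).
split=> //.
  by rewrite -Es mulrCA -exprS prednK // -/h0; ring.
have -> : (1 - 'X) * \sum_(j < m) 'X^j = 1 - 'X^m :> {poly O}.
  by rewrite -opprB mulNr -subrX1 opprB.
rewrite -mul_polyC mulrBr mulrCA !mul_polyC -Es -Et /f1; ring.
Qed.

(** A finite substitute for the geometric series of 1/(1 - rX) modulo f. The reversed polynomial of
    f, evaluated at r, is a unit: f is monic, so its constant term is 1 and the other terms are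
    multiples of pi. *)
Lemma one_sub_nonunit_bezout (f : {poly O}) (r : O) : f \is monic -> max_ideal r ->
  exists s t : {poly O}, 1 = (1 - r *: 'X) * s + t * f.
Proof.
move=> monf /piP[r1 ->].
set c := r1 * pi; pose n := (size f).-1.
have szf : size f = n.+1.
  by rewrite /n prednK // lt0n size_poly_eq0 monic_neq0.
(* c^n f is congruent to the unit kap modulo 1 - c X. *)
pose kap := \sum_(j < n.+1) f`_j * c ^+ (n - j).
pose T := \sum_(j < n.+1) (f`_j * c ^+ (n - j)) *: \sum_(i < j) (c *: 'X) ^+ i.
have ET : c ^+ n *: f = kap%:P - (1 - c *: 'X) * T.
  have -> : f = \sum_(j < n.+1) f`_j *: 'X^j.
    by rewrite -szf -[LHS]coefK poly_def.
  rewrite -mulNr opprB /T mulr_sumr scaler_sumr /kap rmorph_sum /= -big_split /=.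
  apply: eq_bigr => -[j ltj] _ /=.
  rewrite -scalerAr -subrX1 exprZn scalerBr alg_polyC addrC subrK.
  rewrite !scalerA; congr (_ *: _); rewrite -mulrA -exprD subnK //; ring.
have Ukap : kap \is a GRing.unit.
  rewrite /kap big_ord_recr /= subnn expr0 mulr1.
  have -> : f`_n = 1 by rewrite -(monicP monf) lead_coefE.
  have [y ->] : exists y, \sum_(i < n) f`_i * c ^+ (n - i) = y * pi.
    exists (\sum_(i < n) f`_i * c ^+ (n - i).-1 * r1).
    rewrite mulr_suml; apply: eq_bigr => -[j ltj] _ /=.
    by rewrite -[in LHS](@prednK (n - j)) ?subn_gt0 // exprS /c; ring.
  by rewrite addrC; apply: (unit_add_uniformizer piP) => //; apply: unitr1.
exists (kap^-1 *: T), ((kap^-1 * c ^+ n)%:P).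
rewrite mul_polyC -(scalerA kap^-1) ET -scalerAr -scalerDr addrCA subrr addr0.
by rewrite -mul_polyC -rmorphM /= mulVr.
Qed.

End IdempotentLifting.

(** * Local orders *)

Section Orders.
Variables (O : idomainType) (n : nat).
Local Notation K := {fraction O}.
Local Notation M := 'M[K]_n.
Implicit Types (C : set M) (u a x y : M).

(* The last field makes every element of C integral over O, by
   Cayley-Hamilton; a0 need not lie in C, as for a = a0 e_chi. *)
Record order_in C u : Prop := OrderIn {
  order1 : C u;
  orderD : forall x y, C x -> C y -> C (x + y);
  orderM : forall x y, C x -> C y -> C (x *m y);
  orderZ : forall (r : O) x, C x -> C (tofrac r *: x);
  order1l : forall x, C x -> u *m x = x;
  order1r : forall x, C x -> x *m u = x;
  order_integral : forall x, C x -> exists x0 : 'M[O]_n,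
    map_mx (@tofrac O) x0 *m u = x /\ u *m map_mx (@tofrac O) x0 = x }.

Definition unit_in C u x : Prop := exists y, [/\ C y, x *m y = u & y *m x = u].

(** Locality is encoded by the absence of idempotents, which is what primitivity provides directly;
    the usual dichotomy for units is derived from completeness in [local_order_dichotomy]. *)
Definition local_order C u : Prop :=
  [/\ order_in C u, u <> 0 & forall x, C x -> x *m x = x -> x = 0 \/ x = u].

Lemma order0 C u : order_in C u -> C 0.
Proof. by move=> oC; rewrite -(scale0r u) -tofrac0; apply: (orderZ oC); apply: order1 oC. Qed.

Lemma orderN C u x : order_in C u -> C x -> C (- x).
Proof. by move=> oC Cx; rewrite -scaleN1r -tofrac1 -tofracN; apply: (orderZ oC). Qed.

Lemma orderB C u x y : order_in C u -> C x -> C y -> C (x - y).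
Proof. by move=> oC Cx Cy; apply: (orderD oC) => //; apply: (orderN oC). Qed.

Lemma order_sum C u (I : eqType) (r : seq I) (P : pred I) (F : I -> M) :
  order_in C u -> (forall j, j \in r -> P j -> C (F j)) ->
  C (\sum_(j <- r | P j) F j).
Proof.
move=> oC CF; rewrite big_seq_cond.
apply: (big_ind C); first exact: order0 oC.
  by move=> x y; apply: (orderD oC).
by move=> j /andP[rj Pj]; apply: CF.
Qed.

Lemma unit_in_mulr C u x y : order_in C u -> C x -> C y ->
  unit_in C u (x *m y) -> unit_in C u y -> unit_in C u x.
Proof.
move=> oC Cx Cy [z [Cz xyz zxy]] [y' [Cy' yy' y'y]].
exists (y *m z); split; first exact: (orderM oC).
  by rewrite mulmxA.
have -> : x = x *m y *m y' by rewrite -mulmxA yy' (order1r oC).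
by rewrite !mulmxA -(mulmxA (y *m z)) -(mulmxA y z) zxy (order1r oC).
Qed.

Lemma unit_in_commute C u x y : order_in C u -> C x -> C y ->
  x *m y = y *m x -> unit_in C u (x *m y) -> unit_in C u x.
Proof.
move=> oC Cx Cy xy [z [Cz xyz zxy]]; exists (y *m z).
have Cyz := orderM oC Cy Cz.
split=> //; first by rewrite mulmxA.
have E : z *m y *m x = u by rewrite -mulmxA -xy.
have Czy := orderM oC Cz Cy.
by rewrite -[y *m z](order1l oC) // -E -(mulmxA _ x) (mulmxA x) xyz (order1r oC).
Qed.

End Orders.

(** Evaluation at a, factoring through O[X]/(f): evaluate at an integral matrix A with A u = u A =
    a, then multiply by u. This is multiplicative because u commutes with every p(A), and f is the
    characteristic polynomial of A. *)
Lemma order_eval (O : idomainType) n (C : set 'M[{fraction O}]_n) u a :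
  order_in C u -> C a -> exists (f : {poly O}) (ev : {poly O} -> 'M[{fraction O}]_n),
  [/\ f \is monic, ev f = 0, ev 1 = u & ev 'X = a] /\
  [/\ forall p q, ev (p + q) = ev p + ev q,
      forall p q, ev (p * q) = ev p *m ev q,
      forall c p, ev (c *: p) = tofrac c *: ev p & forall p, C (ev p)].
Proof.
(* In size 0 all matrices coincide, so f = 1 and the zero map will do. *)
case: n C u a => [|n] C u a oC Ca.
  have E (x : 'M[{fraction O}]_0) : x = 0 by apply: flatmx0.
  exists 1, (fun _ => 0); split; split=> *;
    first [exact: monic1 | exact: order0 oC | exact: etrans (E _) (esym (E _))].
have [a0 [E1 E2]] := order_integral oC Ca; set A := map_mx _ a0 in E1 E2.
pose h p := horner_mx A (map_poly (@tofrac O) p).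
have hM p q : h (p * q) = h p *m h q by rewrite /h !rmorphM.
have hD p q : h (p + q) = h p + h q by rewrite /h !rmorphD.
have hX : h 'X = A by rewrite /h map_polyX horner_mx_X.
have hC c : h c%:P = (tofrac c)%:M by rewrite /h map_polyC horner_mx_C.
have hu p : h p *m u = u *m h p.
  elim/poly_ind: p => [|p c IHp]; first by rewrite /h !rmorph0 mul0mx mulmx0.
  rewrite hD hM hX hC mulmxDl mulmxDr scalar_mxC; congr (_ + _).
  by rewrite -mulmxA E1 -E2 mulmxA IHp -mulmxA.
have uu : u *m u = u by rewrite (order1l oC) //; apply: order1 oC.
exists (char_poly a0), (fun p => h p *m u); split; split.
- exact: char_poly_monic.
- by rewrite /h map_char_poly Cayley_Hamilton mul0mx.
- by rewrite /h !rmorph1 mul1mx.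
- by rewrite hX.
- by move=> p q; rewrite hD mulmxDl.
- by move=> p q; rewrite hM -!mulmxA (mulmxA u) -hu -mulmxA uu.
- by move=> c p; rewrite /h map_polyZ linearZ -scalemxAl.
elim/poly_ind=> [|p c IHp]; first by rewrite /h !rmorph0 mul0mx; apply: order0 oC.
rewrite hD hM hX hC mulmxDl mul_scalar_mx -mulmxA E1.
rewrite -{1}(order1l oC Ca) mulmxA; apply: (orderD oC); first exact: (orderM oC).
by apply: (orderZ oC); apply: order1 oC.
Qed.

(** * Units in local orders over a complete ring *)

Section LocalOrders.
Variables (O : idomainType) (hO : complete_dvr O).
Variables (k : fieldType) (red : {rmorphism O -> k}) (hred : is_residue_map red).
Variable n : nat.
Local Notation K := {fraction O}.
Local Notation M := 'M[K]_n.
Implicit Types (C : set M) (u a x y : M).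

(** In effect J(O)C lies in the radical of C: the Bezout identity for 1 - rX and f is evaluated at
    a, where f vanishes. *)
Lemma unit_in_sub_nonunit C u a (r : O) : order_in C u -> C a ->
  max_ideal r -> unit_in C u (u - tofrac r *: a).
Proof.
move=> oC Ca mr; have [f [ev [[monf f0 ev1 evX] [evD evM evZ evC]]]] := order_eval oC Ca.
have [pi piP] := dvr_uniformizer hO.1.
have [s [t Est]] := one_sub_nonunit_bezout hO piP monf mr.
have evB p q : ev (p - q) = ev p - ev q.
  by apply/eqP; rewrite eq_sym subr_eq -evD subrK.
have E : ev (1 - r *: 'X) = u - tofrac r *: a by rewrite evB ev1 evZ evX.
have Es : ev ((1 - r *: 'X) * s) = u.
  by rewrite -ev1 [in RHS]Est evD (evM t) f0 mulmx0 addr0.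
by exists (ev s); split=> //; rewrite -E -evM // mulrC.
Qed.

(** The Fitting idempotent evaluated at a is u or 0. In the first case a divides a unit of the form
    u - pi c, in the second u - a does; all elements in play are polynomials in a and commute, so
    these divisors are units. *)
Lemma local_order_dichotomy C u a : local_order C u -> C a ->
  unit_in C u a \/ unit_in C u (u - a).
Proof.
move=> [oC nzu idC] Ca.
have [f [ev [[monf f0 ev1 evX] [evD evM evZ evC]]]] := order_eval oC Ca.
have [pi piP] := dvr_uniformizer hO.1.
have mpi : max_ideal pi by apply: uniformizer_nonunit piP.
have evB p q : ev (p - q) = ev p - ev q.
  by apply/eqP; rewrite eq_sym subr_eq -evD subrK.
have [h [w1 [w2 [w3 [w4 [q [r1 [r2 [E1 E2 E3]]]]]]]]] :=
  fitting_idem hO piP hred monf.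
have idh : ev h *m ev h = ev h.
  apply/eqP; rewrite -evM -subr_eq0 -evB; apply/eqP.
  by rewrite -[h * h]expr2 E1 evM f0 mulmx0.
have [h0|hu] := idC _ (evC h) idh; [right | left].
  apply: (unit_in_commute oC (y := ev w2)); first exact: (orderB oC (order1 oC)).
  - exact: evC.
  - by rewrite -evX -ev1 -evB -!evM mulrC.
  have -> : (u - a) *m ev w2 = u - tofrac pi *: ev r2.
    rewrite -{1}evX -{1}ev1 -evB -evM; apply/eqP; rewrite eq_sym subr_eq; apply/eqP.
    by rewrite -ev1 [in LHS]E3 !evD (evM w3) h0 (evM w4) f0 !mulmx0 !addr0 evZ.
  exact: unit_in_sub_nonunit.
apply: (unit_in_commute oC (y := ev w1)) => //.
  by rewrite -evX -!evM mulrC.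
have -> : a *m ev w1 = u - tofrac pi *: ev r1.
  by apply/eqP; rewrite eq_sym subr_eq -hu [h in ev h]E2 evD evM evX evZ.
exact: unit_in_sub_nonunit.
Qed.

(** Plays the part of Rosenberg's lemma. Multiplying by the inverse y normalizes the sum to u, and
    the dichotomy applied to the first term times y either settles it or leaves a unit in the
    remaining sum. *)
Lemma local_order_unit_sum C u (I : eqType) (s : seq I) (F : I -> M) :
  local_order C u -> (forall j, j \in s -> C (F j)) ->
  unit_in C u (\sum_(j <- s) F j) -> exists2 j, j \in s & unit_in C u (F j).
Proof.
move=> loC; have [oC nzu _] := loC.
elim: s => [|j s IHs] CF.
  by rewrite big_nil => -[y [_ E _]]; case: nzu; rewrite -E mul0mx.
rewrite big_cons => -[y [Cy E1 E2]].
have Cj : C (F j) by apply: CF; apply: mem_head.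
have CF' i : i \in s -> C (F i) by move=> si; apply: CF; rewrite inE si orbT.
have Cs : C (\sum_(i <- s) F i) by apply: order_sum oC _ => i si _; apply: CF'.
have Uy : unit_in C u y.
  by exists (F j + \sum_(i <- s) F i); split=> //; apply: (orderD oC).
have [Uj|Us] := local_order_dichotomy loC (orderM oC Cj Cy).
  by exists j; [apply: mem_head | apply: unit_in_mulr oC Cj Cy _ _].
have [|i si Ui] := IHs CF'; last by exists i => //; rewrite inE si orbT.
apply: (unit_in_mulr oC Cs Cy) => //.
by move: Us; rewrite -[X in X - _]E1 mulmxDl addrAC subrr add0r.
Qed.

End LocalOrders.

(** * Relative traces and the Mackey formula *)

Lemma add_spanP (V : nmodType) (S : set V) (P : V -> Prop) :
  P 0 -> (forall x y, P x -> P y -> P (x + y)) -> (forall x, S x -> P x) ->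
  forall x, add_span S x -> P x.
Proof.
move=> P0 PD SP x [s [sS ->]]; rewrite big_seq.
by apply: (big_ind P) => // y sy; apply/SP/sS.
Qed.

Lemma add_span0 (V : nmodType) (S : set V) : add_span S 0.
Proof. by exists [::]; split=> //; rewrite big_nil. Qed.

Lemma add_spanD (V : nmodType) (S : set V) x y :
  add_span S x -> add_span S y -> add_span S (x + y).
Proof.
move=> [s [sS ->]] [t [tS ->]]; exists (s ++ t); split; last by rewrite big_cat.
by move=> z; rewrite mem_cat => /orP[/sS|/tS].
Qed.

Lemma add_span_gen (V : nmodType) (S : set V) x : S x -> add_span S x.
Proof.
move=> Sx; exists [:: x]; split; last by rewrite big_seq1.
by move=> z; rewrite inE => /eqP->.
Qed.

Section GroupAlgebraTheory.
Variables (O : idomainType) (gT : finGroupType) (G : {group gT}).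
Local Notation K := {fraction O}.
Local Notation M := 'M[K]_#|G|.
Implicit Types (C : set M) (P Q R H D : {group gT}) (a b c e i u z : M) (x y g : gT).

Local Notation conj := (@conj_by O gT G).

Lemma gelt1 : gelt O G 1%g = 1%:M.
Proof. exact: repr_mx1. Qed.

Lemma geltM x y : x \in G -> y \in G -> gelt O G (x * y)%g = gelt O G x *m gelt O G y.
Proof. exact: repr_mxM. Qed.

Lemma geltVl x : x \in G -> gelt O G x^-1%g *m gelt O G x = 1%:M.
Proof. by move=> Gx; rewrite -geltM ?groupV // mulVg gelt1. Qed.

Lemma geltVr x : x \in G -> gelt O G x *m gelt O G x^-1%g = 1%:M.
Proof. by move=> Gx; rewrite -geltM ?groupV // mulgV gelt1. Qed.

Lemma conj1 a : conj 1%g a = a.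
Proof. by rewrite /conj_by invg1 gelt1 mul1mx mulmx1. Qed.

Lemma conjMg x y a : x \in G -> y \in G -> conj (x * y)%g a = conj x (conj y a).
Proof. by move=> Gx Gy; rewrite /conj_by invMg !geltM ?groupV // !mulmxA. Qed.

Lemma conjKg x a : x \in G -> conj x^-1%g (conj x a) = a.
Proof. by move=> Gx; rewrite -conjMg ?groupV // mulVg conj1. Qed.

Lemma conjKVg x a : x \in G -> conj x (conj x^-1%g a) = a.
Proof. by move=> Gx; rewrite -conjMg ?groupV // mulgV conj1. Qed.

Lemma conjM x a b : x \in G -> conj x (a *m b) = conj x a *m conj x b.
Proof.
by move=> Gx; rewrite /conj_by !mulmxA -(mulmxA _ _ (gelt O G x)) geltVl // mulmx1.
Qed.

Lemma conjD x a b : conj x (a + b) = conj x a + conj x b.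
Proof. by rewrite /conj_by mulmxDr mulmxDl. Qed.

Lemma conjZ x (r : K) a : conj x (r *: a) = r *: conj x a.
Proof. by rewrite /conj_by -scalemxAr -scalemxAl. Qed.

Lemma conj0 x : conj x 0 = 0.
Proof. by have := conjZ x 0 0; rewrite !scale0r. Qed.

Lemma conj_sum x (I : Type) (r : seq I) (p : pred I) (F : I -> M) :
  conj x (\sum_(j <- r | p j) F j) = \sum_(j <- r | p j) conj x (F j).
Proof. exact: (big_morph _ (conjD x) (conj0 x)). Qed.

Lemma conj_commute x a : x \in G -> gelt O G x *m a = a *m gelt O G x -> conj x a = a.
Proof. by move=> Gx E; rewrite /conj_by E -mulmxA geltVr // mulmx1. Qed.

Lemma commute_conj x a : x \in G -> conj x a = a -> gelt O G x *m a = a *m gelt O G x.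
Proof. by move=> Gx {2}<-; rewrite /conj_by -!mulmxA geltVl // mulmx1. Qed.

Definition fixed_by P a := forall x, x \in P -> conj x a = a.

Lemma fixed_byM P a b : P \subset G -> fixed_by P a -> fixed_by P b -> fixed_by P (a *m b).
Proof. by move=> /subsetP sPG Fa Fb x Px; rewrite conjM ?Fa ?Fb ?sPG. Qed.

Lemma fixed_byD P a b : fixed_by P a -> fixed_by P b -> fixed_by P (a + b).
Proof. by move=> Fa Fb x Px; rewrite conjD Fa ?Fb. Qed.

Lemma fixed_byZ P (r : K) a : fixed_by P a -> fixed_by P (r *: a).
Proof. by move=> Fa x Px; rewrite conjZ Fa. Qed.

Lemma fixed_byS P Q a : Q \subset P -> fixed_by P a -> fixed_by Q a.
Proof. by move=> /subsetP sQP Fa x Qx; apply/Fa/sQP. Qed.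

Lemma fixed_byJ P x a : P \subset G -> x \in G -> fixed_by P a ->
  fixed_by (P :^ x^-1) (conj x a).
Proof.
move=> /subsetP sPG Gx Fa y; rewrite mem_conjgV => Py.
have Gyx := sPG _ Py; have Gy : y \in G by rewrite -(groupJr _ Gx).
by rewrite -conjMg // conjgC conjMg // Fa.
Qed.

Section RelativeTrace.
Hypothesis hK : [pchar K] =i pred0.

Lemma natK_neq0 n : (0 < n)%N -> n%:R != 0 :> K.
Proof. by move=> n_gt0; rewrite ((pcharf0P _).1 hK) -lt0n. Qed.

(** Each coset of Q contributes #|Q| equal terms, and #|Q| is invertible in K. Coset representatives
    thereby disappear from all later computations. *)
Lemma rel_trace_avg Q P a : Q \subset P -> P \subset G -> fixed_by Q a ->
  rel_trace Q P a = (#|Q|%:R)^-1 *: \sum_(x in P) conj x a.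
Proof.
move=> sQP sPG Fa; have /subsetP sPG' := sPG.
rewrite (partition_big (fun x => x *: Q)%g (mem (lcosets Q P))) /=; last first.
  by move=> x Px; apply/lcosetsP; exists x.
rewrite scaler_sumr; apply: eq_bigr => X /lcosetsP[x Px ->].
have rX : repr (x *: Q)%g \in (x *: Q)%g by rewrite (mem_repr x) ?lcoset_refl.
have sXP : (x *: Q)%g \subset P by rewrite mul_subG ?sub1set.
rewrite (eq_bigl (mem (x *: Q)%g)); last first.
  move=> y /=; apply/andP/idP => [[_ /eqP<-] | xQy]; first exact: lcoset_refl.
  by split; [apply: (subsetP sXP) | apply/eqP/lcoset_eqP].
rewrite (eq_bigr (fun _ => conj (repr (x *: Q)%g) a)) => [|y xQy].
  rewrite sumr_const card_lcoset -scaler_nat scalerA mulVf ?scale1r //.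
  by rewrite natK_neq0 ?cardG_gt0.
have /lcosetP[q Qq ->] : y \in (repr (x *: Q) *: Q)%g.
  by rewrite (lcoset_eqP rX).
have Gq : q \in G := sPG' _ (subsetP sQP _ Qq).
have Gr := sPG' _ (subsetP sXP _ rX).
by rewrite conjMg ?(Fa q).
Qed.

Lemma conj_sum_group P x a : P \subset G -> x \in P ->
  \sum_(y in P) conj (y * x)%g a = \sum_(y in P) conj y a.
Proof.
move=> sPG Px; rewrite [RHS](reindex_inj (mulIg x)) /=.
by apply: eq_bigl => y; rewrite groupMr.
Qed.

Lemma rel_trace_fixed Q P a : Q \subset P -> P \subset G -> fixed_by Q a ->
  fixed_by P (rel_trace Q P a).
Proof.
move=> sQP sPG Fa x Px; have /subsetP sPG' := sPG.
rewrite rel_trace_avg // conjZ; congr (_ *: _).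
rewrite conj_sum [RHS](reindex_inj (mulgI x)) /=.
apply: eq_big => y; first by rewrite groupMl.
by move=> Py; rewrite conjMg ?sPG'.
Qed.

Lemma rel_trace_id P a : P \subset G -> fixed_by P a -> rel_trace P P a = a.
Proof.
move=> sPG Fa; rewrite rel_trace_avg // (eq_bigr (fun _ => a)) => [|x Px].
  rewrite sumr_const -scaler_nat scalerA mulVf ?scale1r //.
  by rewrite natK_neq0 ?cardG_gt0.
exact: Fa.
Qed.

Lemma rel_trace_trans R Q P a : R \subset Q -> Q \subset P -> P \subset G ->
  fixed_by R a -> rel_trace Q P (rel_trace R Q a) = rel_trace R P a.
Proof.
move=> sRQ sQP sPG Fa; have sQG := subset_trans sQP sPG.
have sRP := subset_trans sRQ sQP; have /subsetP sPG' := sPG.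
rewrite [LHS]rel_trace_avg //; last exact: rel_trace_fixed.
rewrite !(rel_trace_avg (Q := R)) //.
under eq_bigr => x Px do rewrite conjZ conj_sum.
rewrite -scaler_sumr exchange_big /=.
rewrite (eq_bigr (fun _ => \sum_(x in P) conj x a)) => [|q Qq].
  rewrite sumr_const -scaler_nat !scalerA mulrC mulrA mulfV ?mul1r //.
  by rewrite natK_neq0 ?cardG_gt0.
rewrite -(conj_sum_group a sPG (subsetP sQP q Qq)).
by apply: eq_bigr => x Px; rewrite conjMg ?sPG' // (subsetP sQP).
Qed.

Lemma rel_trace_mull Q P z a : Q \subset P -> P \subset G -> fixed_by P z ->
  z *m rel_trace Q P a = rel_trace Q P (z *m a).
Proof.
move=> sQP sPG Fz; rewrite /rel_trace mulmx_sumr.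
apply: eq_bigr => X /lcosetsP[x Px ->].
have rX : repr (x *: Q)%g \in P.
  apply: (subsetP (_ : (x *: Q)%g \subset P)).
    by rewrite mul_subG ?sub1set.
  by rewrite (mem_repr x) ?lcoset_refl.
by rewrite conjM ?Fz // (subsetP sPG).
Qed.

Lemma rel_trace_mulr Q P z a : Q \subset P -> P \subset G -> fixed_by P z ->
  rel_trace Q P a *m z = rel_trace Q P (a *m z).
Proof.
move=> sQP sPG Fz; rewrite /rel_trace mulmx_suml.
apply: eq_bigr => X /lcosetsP[x Px ->].
have rX : repr (x *: Q)%g \in P.
  apply: (subsetP (_ : (x *: Q)%g \subset P)).
    by rewrite mul_subG ?sub1set.
  by rewrite (mem_repr x) ?lcoset_refl.
by rewrite conjM ?Fz // (subsetP sPG).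
Qed.

Lemma rel_traceD Q P a b : rel_trace Q P (a + b) = rel_trace Q P a + rel_trace Q P b.
Proof. by rewrite -big_split; apply: eq_bigr => X _; rewrite conjD. Qed.

Lemma rel_traceZ Q P r a : rel_trace Q P (r *: a) = r *: rel_trace Q P a.
Proof. by rewrite scaler_sumr; apply: eq_bigr => X _; rewrite conjZ. Qed.

Lemma rel_traceJ Q P x a : Q \subset P -> P \subset G -> x \in G -> fixed_by Q a ->
  conj x (rel_trace Q P a) = rel_trace (Q :^ x^-1) (P :^ x^-1) (conj x a).
Proof.
move=> sQP sPG Gx Fa; have /subsetP sPG' := sPG.
have sQG := subset_trans sQP sPG.
rewrite !rel_trace_avg ?conjSg //; first last.
- exact: fixed_byJ.
- by rewrite -(conjGid (groupVr Gx)) conjSg.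
rewrite cardJg conjZ; congr (_ *: _).
rewrite conj_sum [RHS](reindex_inj (@conjg_inj _ x^-1%g)) /=.
apply: eq_big => y; first by rewrite memJ_conjg.
move=> Py; have Gy := sPG' _ Py.
rewrite -!conjMg ?groupJ ?groupV //; congr (conj _ a).
by rewrite conjgE invgK !mulgA mulgVK.
Qed.

(* The pairs (q, d) with q x d = g form one coset of Q :&: xDx^-1. *)
Lemma double_coset_sum Q D x a : Q \subset G -> D \subset G -> x \in G ->
    fixed_by D a ->
  \sum_(g in ((Q :* x) * D)%g) conj g a
    = #|D|%:R *: rel_trace (Q :&: D :^ x^-1) Q (conj x a).
Proof.
move=> /subsetP sQG /subsetP sDG Gx Fa.
set R := (Q :&: D :^ x^-1)%G; pose m := #|R|%:R : K.
have nzm : m != 0 by rewrite natK_neq0 ?cardG_gt0.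
apply: (scalerI nzm).
rewrite rel_trace_avg ?subsetIl //; first last.
- apply: fixed_byS (subsetIr _ _) _; apply: fixed_byJ => //.
  exact/subsetP.
- exact/subsetP.
rewrite [RHS]scalerA mulrC -scalerA (scalerA m) mulfV // scale1r.
(* Double counting: summing over d gives a factor #|D|, while each g in QxD comes from exactly #|R|
   pairs. *)
transitivity (\sum_(p in setX Q D) conj (p.1 * x * p.2)%g a); last first.
  rewrite (eq_bigl (fun p => (p.1 \in Q) && (p.2 \in D))) => [|p]; last by rewrite inE.
  rewrite -(pair_big (mem Q) (mem D) (fun q d => conj (q * x * d)%g a)) /=.
  rewrite scaler_sumr; apply: eq_bigr => q Qq.
  have Gq := sQG _ Qq; rewrite -conjMg //.
  transitivity (\sum_(d in D) conj (q * x)%g a).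
    apply: eq_bigr => d Dd; have Gd := sDG _ Dd.
    by rewrite [LHS]conjMg ?groupM // (Fa d Dd).
  by rewrite sumr_const -scaler_nat.
rewrite [RHS](partition_big (fun p => (p.1 * x * p.2)%g) (mem ((Q :* x) * D)%g)) /=; last first.
  case=> q d /setXP[Qq Dd]; apply: mem_mulg => //=.
  by apply/rcosetP; exists q.
rewrite scaler_sumr; apply: eq_bigr => g /mulsgP[q' d0 /rcosetP[q0 Qq0 ->] Dd0 ->].
rewrite (eq_bigr (fun _ => conj (q0 * x * d0)%g a)) => [|p /andP[_ /eqP->] //].
rewrite sumr_const -scaler_nat; congr (_%:R *: _).
(* For t in R, (q0 t) x (x^-1 t^-1 x) d0 = q0 x d0: this parametrizes the fibre over q0 x d0. *)
pose h t := ((q0 * t)%g, ((t^-1) ^ x * d0)%g).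
have injh : injective h by move=> s t [/mulgI].
rewrite -(card_imset _ injh) /=; apply: eq_card => -[q d].
rewrite [RHS]unfold_in /= in_setX; apply/imsetP/andP => [[t] | [/andP[Qq Dd] /eqP E]].
  rewrite inE mem_conjgV => /andP[Qt Dt] [-> ->]; split.
    by apply/andP; split; rewrite groupM // conjVg groupV.
  apply/eqP; rewrite conjgE !mulgA mulgK; congr (_ * _)%g.
  by rewrite -!mulgA; congr (_ * _)%g; rewrite mulKVg.
exists (q0^-1 * q)%g.
  rewrite inE groupM ?groupV //= mem_conjgV.
  have -> : ((q0^-1 * q) ^ x = d0 * d^-1)%g.
    have -> : (q = q0 * x * d0 * d^-1 * x^-1)%g by rewrite -E !mulgK.
    by rewrite conjgE -!mulgA mulVg mulg1 !mulKg.
  by rewrite groupM ?groupV.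
rewrite /h mulKVg; congr (_, _).
have -> : (d = x^-1 * q^-1 * q0 * x * d0)%g by rewrite -!mulgA (mulgA q0) -E -!mulgA mulKg mulKg.
by rewrite conjgE invMg invgK !mulgA.
Qed.

(** The list s consists of representatives of the (Q, D) double cosets; they are split off one at a
    time, by induction over subsets of G that are unions of double cosets. *)
Lemma mackey Q D a : Q \subset G -> D \subset G -> fixed_by D a ->
  exists s : seq gT, {subset s <= G} /\
    rel_trace D G a = \sum_(x <- s) rel_trace (Q :&: D :^ x^-1) Q (conj x a).
Proof.
move=> sQG sDG Fa; rewrite rel_trace_avg //.
pose stable (S : {set gT}) := forall x, x \in S -> ((Q :* x) * D)%g \subset S.
suff H (S : {set gT}) : S \subset G -> stable S -> exists s : seq gT,
    {subset s <= G} /\ \sum_(g in S) conj g a =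
      #|D|%:R *: \sum_(x <- s) rel_trace (Q :&: D :^ x^-1) Q (conj x a).
  have [|s [sG ->]] := H _ (subxx G).
    by move=> x Gx; rewrite !mul_subG ?sub1set.
  exists s; split=> //; rewrite scalerA mulVf ?scale1r //.
  by rewrite natK_neq0 ?cardG_gt0.
have [n] := ubnP #|S|; elim: n S => // n IHn S ltSn sSG stS.
have [->|[x Sx]] := set_0Vmem S.
  by exists [::]; split=> //; rewrite big_set0 big_nil scaler0.
have Gx := subsetP sSG x Sx.
pose X := ((Q :* x) * D)%g.
have Xx : x \in X.
  by rewrite -[x]mulg1 -[x]mul1g !mem_mulg ?set11 ?group1.
have sXS : X \subset S := stS x Sx.
have [||| s [sG Es]] := IHn (S :\: X).
- apply: leq_trans (ltSn : #|S| <= n)%N; rewrite -(cardsID X S).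
  rewrite -[X in (X < _)%N]add0n ltn_add2r card_gt0.
  by apply/set0Pn; exists x; rewrite inE Sx.
- exact: subset_trans (subsetDl _ _) sSG.
(* Removing QxD leaves a union of double cosets: if QyD meets QxD, then y lies in QxD. *)
- move=> y /setDP[Sy nXy]; apply/subsetP=> g Yg; apply/setDP; split.
    exact: subsetP (stS y Sy) _ Yg.
  apply: contra nXy => /mulsgP[q1 d1 /rcosetP[q2 Qq2 ->] Dd1 Eg].
  case/mulsgP: Yg => q3 d3 /rcosetP[q4 Qq4 ->] Dd3 Eg'.
  have -> : (y = (q4^-1 * q2 * x) * (d1 * d3^-1))%g.
    have -> : (y = q4^-1 * g * d3^-1)%g by rewrite Eg' -!mulgA mulgV mulg1 mulKg.
    by rewrite Eg !mulgA.
  apply: mem_mulg; last by rewrite groupM ?groupV.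
  by apply/rcosetP; exists (q4^-1 * q2)%g; rewrite ?groupM ?groupV.
exists (x :: s); split.
  by move=> y; rewrite inE => /orP[/eqP->|/sG].
rewrite big_cons scalerDr -double_coset_sum // -Es (big_setID X) /=.
by rewrite (setIidPr sXS).
Qed.

End RelativeTrace.
End GroupAlgebraTheory.

(** * Brauer quotients *)

Section BrauerKernel.
Variables (O : idomainType) (gT : finGroupType) (G : {group gT}).
Local Notation K := {fraction O}.
Local Notation M := 'M[K]_#|G|.
Hypothesis hK : [pchar K] =i pred0.
Implicit Types (C : set M) (P Q R H D : {group gT}) (a b c e i u z w : M) (x y g : gT).

Local Notation conj := (@conj_by O gT G).

Definition stable_under H C := forall x a, x \in H -> C a -> C (conj x a).

Lemma fixedW C Q R a : R \subset Q -> fixed C Q a -> fixed C R a.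
Proof. by move=> sRQ [Ca Fa]; split=> //; apply: fixed_byS sRQ Fa. Qed.

Lemma fixedM C u Q a b : order_in C u -> Q \subset G ->
  fixed C Q a -> fixed C Q b -> fixed C Q (a *m b).
Proof.
by move=> oC sQG [Ca Fa] [Cb Fb]; split; [apply: (orderM oC) | apply: fixed_byM].
Qed.

Lemma fixedZ C u Q (r : O) a : order_in C u -> fixed C Q a ->
  fixed C Q (tofrac r *: a).
Proof. by move=> oC [Ca Fa]; split; [apply: (orderZ oC) | apply: fixed_byZ]. Qed.

Lemma fixedJ C Q x a : stable_under G C -> Q \subset G -> x \in G ->
  fixed C Q a -> fixed C (Q :^ x^-1)%G (conj x a).
Proof. by move=> sC sQG Gx [Ca Fa]; split; [apply: sC | apply: fixed_byJ]. Qed.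

Lemma rel_trace_in C u Q P a : order_in C u -> stable_under P C ->
  Q \subset P -> C a -> C (rel_trace Q P a).
Proof.
move=> oC sC sQP Ca; apply: (order_sum oC) => X _ /lcosetsP[x Px ->].
apply: sC => //; apply: (subsetP (_ : (x *: Q)%g \subset P)).
  by rewrite mul_subG ?sub1set.
by rewrite (mem_repr x) ?lcoset_refl.
Qed.

Lemma fixed_rel_trace C u Q P a : order_in C u -> stable_under P C ->
  Q \subset P -> P \subset G -> fixed C Q a -> fixed C P (rel_trace Q P a).
Proof.
move=> oC sC sQP sPG [Ca Fa].
by split; [apply: rel_trace_in oC sC sQP Ca | apply: rel_trace_fixed].
Qed.

Lemma fixed_order C u P : order_in C u -> P \subset G -> fixed_by P u ->
  order_in (fixed C P) u.
Proof.
move=> oC sPG Fu; split.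
- by split=> //; apply: order1 oC.
- by move=> a b [Ca Fa] [Cb Fb]; split; [apply: (orderD oC) | apply: fixed_byD].
- by move=> a b Ca Cb; apply: fixedM oC _ _ _.
- by move=> r a Ca; apply: fixedZ oC _.
- by move=> a [Ca _]; apply: (order1l oC).
- by move=> a [Ca _]; apply: (order1r oC).
- by move=> a [Ca _]; apply: (order_integral oC).
Qed.

Lemma brauer_ker_trace C Q R a : R \proper Q -> fixed C R a ->
  brauer_ker C Q (rel_trace R Q a).
Proof. by move=> pRQ Ca; apply: add_span_gen; left; exists R, a. Qed.

Lemma brauer_ker_ind C Q (S : M -> Prop) :
  S 0 -> (forall a b, S a -> S b -> S (a + b)) ->
  (forall R a, R \proper Q -> fixed C R a -> S (rel_trace R Q a)) ->
  (forall (r : O) a, max_ideal r -> fixed C Q a -> S (tofrac r *: a)) ->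
  forall a, brauer_ker C Q a -> S a.
Proof.
move=> S0 SD ST SZ; apply: add_spanP => // a [[R [a' [pRQ Ca ->]]] | [r [a' [mr Ca ->]]]].
  exact: ST.
exact: SZ.
Qed.

(** The kernel is a two-sided ideal of C^Q, since z Tr(a) = Tr(z a) and Tr(a) z = Tr(a z) for z
    fixed by Q. *)
Lemma brauer_kerM C u Q z w : order_in C u -> Q \subset G -> fixed C Q z ->
  brauer_ker C Q w -> brauer_ker C Q (z *m w) /\ brauer_ker C Q (w *m z).
Proof.
move=> oC sQG Cz; have [_ Fz] := Cz; move: w; apply: brauer_ker_ind.
- by rewrite mulmx0 mul0mx; split; apply: add_span0.
- by move=> a b [? ?] [? ?]; rewrite mulmxDr mulmxDl; split; apply: add_spanD.
- move=> R a pRQ Ca; have sRQ := proper_sub pRQ.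
  have CzR := fixedW sRQ Cz; have sRG := subset_trans sRQ sQG.
  rewrite rel_trace_mull // rel_trace_mulr //.
  by split; apply: brauer_ker_trace => //; apply: fixedM oC _ _ _.
move=> r a mr Ca; rewrite -scalemxAr -scalemxAl.
by split; apply: add_span_gen; right; exists r; eexists; split; try reflexivity;
  rewrite //; apply: fixedM oC _ _ _.
Qed.

Lemma brauer_kerN C u Q w : order_in C u -> brauer_ker C Q w -> brauer_ker C Q (- w).
Proof.
move=> oC; move: w; apply: brauer_ker_ind.
- by rewrite oppr0; apply: add_span0.
- by move=> a b ka kb; rewrite opprD; apply: add_spanD.
- move=> R a pRQ Ca; rewrite -scaleN1r -rel_traceZ; apply: brauer_ker_trace => //.
  by rewrite -tofrac1 -tofracN; apply: fixedZ oC _.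
move=> r a mr Ca; rewrite -scalerN; apply: add_span_gen; right; exists r, (- a).
by split=> //; rewrite -scaleN1r -tofrac1 -tofracN; apply: fixedZ oC _.
Qed.

Lemma brauer_ker_sandwich C C' Q z w : Q \subset G -> fixed_by Q z ->
  (forall a, C a -> C' (z *m a *m z)) ->
  brauer_ker C Q w -> brauer_ker C' Q (z *m w *m z).
Proof.
move=> sQG Fz CC'; have FF R a : R \subset Q -> fixed C R a -> fixed C' R (z *m a *m z).
  move=> sRQ [Ca Fa]; have sRG := subset_trans sRQ sQG.
  have FzR := fixed_byS sRQ Fz.
  by split; [apply: CC' | do 2!apply: fixed_byM => //].
move: w; apply: brauer_ker_ind.
- by rewrite mulmx0 mul0mx; apply: add_span0.
- by move=> a b ka kb; rewrite mulmxDr mulmxDl; apply: add_spanD.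
- move=> R a pRQ Ca; have sRQ := proper_sub pRQ.
  rewrite rel_trace_mull // rel_trace_mulr //.
  by apply: brauer_ker_trace => //; apply: FF.
move=> r a mr Ca; rewrite -scalemxAr -scalemxAl.
by apply: add_span_gen; right; exists r; eexists; split; try reflexivity; rewrite //; apply: FF.
Qed.

Lemma brauer_kerS C C' Q w : (forall a, C a -> C' a) ->
  brauer_ker C Q w -> brauer_ker C' Q w.
Proof.
move=> CC'; have FF R a : fixed C R a -> fixed C' R a by case=> Ca Fa; split; auto.
move: w; apply: brauer_ker_ind.
- exact: add_span0.
- by move=> a b ka kb; apply: add_spanD.
- by move=> R a pRQ Ca; apply: brauer_ker_trace => //; apply: FF.
by move=> r a mr Ca; apply: add_span_gen; right; exists r, a; split; auto.
Qed.

Lemma brauer_kerJ C Q x w : stable_under G C -> Q \subset G -> x \in G ->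
  brauer_ker C Q w -> brauer_ker C (Q :^ x^-1)%G (conj x w).
Proof.
move=> sC sQG Gx; move: w; apply: brauer_ker_ind.
- by rewrite conj0; apply: add_span0.
- by move=> a b ka kb; rewrite conjD; apply: add_spanD.
- move=> R a pRQ Ca; have sRQ := proper_sub pRQ; have [_ Fa] := Ca.
  rewrite rel_traceJ //; apply: brauer_ker_trace; first by rewrite properJ.
  by apply: fixedJ => //; apply: subset_trans sRQ sQG.
move=> r a mr Ca; rewrite conjZ; apply: add_span_gen; right; exists r; eexists.
by split; try reflexivity; rewrite //; apply: fixedJ.
Qed.

Lemma brauer_map_eq0 C u Q a : order_in C u ->
  brauer_map C Q a = brauer_map C Q 0 <-> brauer_ker C Q a.
Proof.
move=> oC; split=> [E | ka].
  have : brauer_map C Q a a by exists 0; [apply: add_span0 | rewrite addr0].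
  by rewrite E => -[c kc <-]; rewrite add0r.
apply/predeqP => z; split=> [[c kc <-] | [c kc <-]].
  by exists (a + c); [apply: add_spanD | rewrite add0r].
exists (c - a); last by rewrite addrC subrK add0r.
by apply: add_spanD => //; apply: brauer_kerN oC ka.
Qed.

(** The kernel being an ideal, the quotient vanishes exactly when the class of the identity does. *)
Lemma brauer_nonzeroP C u Q : order_in C u -> Q \subset G -> fixed_by Q u ->
  brauer_nonzero C Q <-> ~ brauer_ker C Q u.
Proof.
move=> oC sQG Fu; have Cu : fixed C Q u by split=> //; apply: order1 oC.
split=> [nz ku | nku E].
  apply: nz; apply/predeqP => X; split=> [[a Ca <-] | ->].
    apply/(brauer_map_eq0 _ _ oC).
    by have [_] := brauer_kerM oC sQG Ca ku; case: Ca => Ca _; rewrite (order1l oC).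
  exists 0 => //; split; first exact: order0 oC.
  by move=> x _; rewrite conj0.
have : brauer_quotient C Q (brauer_map C Q u) by exists u.
by rewrite E => /(brauer_map_eq0 _ _ oC).
Qed.

(** In Mackey's formula a term whose intersection with Q is proper lies in the kernel by definition.
    Some term survives, so Q lies in xDx^-1 and the trace in that term is trivial. *)
Lemma brauer_ker_rel_trace C u Q D a : order_in C u -> stable_under G C ->
  Q \subset G -> D \subset G -> fixed C D a ->
  ~ brauer_ker C Q (rel_trace D G a) ->
  exists x, [/\ x \in G, Q \subset D :^ x^-1 & ~ brauer_ker C Q (conj x a)].
Proof.
move=> oC sC sQG sDG Ca nk; have [_ Fa] := Ca.
have [s [sG Es]] := mackey hK sQG sDG Fa.
have [x [sx nkx]] : exists x, x \in s /\
    ~ brauer_ker C Q (rel_trace (Q :&: D :^ x^-1) Q (conj x a)).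
  apply: contrapT => H; apply: nk; rewrite Es big_seq.
  apply: (big_ind (brauer_ker C Q)).
  - exact: add_span0.
  - by move=> ? ?; apply: add_spanD.
  by move=> x sx; apply: contrapT => nkx; apply: H; exists x.
have Gx := sG _ sx.
have CxD := fixedJ sC sDG Gx Ca.
have sQD : Q \subset D :^ x^-1.
  apply/setIidPl/eqP; rewrite eqEproper subsetIl; apply/negP => pRQ.
  by apply: nkx; apply: brauer_ker_trace => //; apply: fixedW (subsetIr _ _) CxD.
exists x; split=> //.
have ER : (Q :&: D :^ x^-1)%G = Q by apply/val_inj/setIidPl.
move: nkx; rewrite [X in rel_trace X]ER rel_trace_id //.
by case: (fixedW sQD CxD).
Qed.

End BrauerKernel.

(** * Orders in the group algebra *)

Section GroupOrders.
Variables (O : idomainType) (gT : finGroupType) (G : {group gT}).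
Local Notation K := {fraction O}.
Local Notation M := 'M[K]_#|G|.
Implicit Types (C : set M) (P Q R H D : {group gT}) (a b c e i u z w : M) (x y g : gT).

Local Notation conj := (@conj_by O gT G).
Local Notation OG := (@OG O gT G).
Local Notation KG := (@KG O gT G).

Lemma OG_gelt x : x \in G -> OG (gelt O G x).
Proof.
move=> Gx; exists (fun y => (y == x)%:R) => //.
rewrite (bigD1 x) //= eqxx tofrac1 scale1r big1 ?addr0 // => y /andP[_ /negPf->].
by rewrite tofrac0 scale0r.
Qed.

Lemma OG0 : OG 0.
Proof. by exists (fun _ => 0) => //; rewrite big1 // => x _; rewrite tofrac0 scale0r. Qed.

Lemma OGD a b : OG a -> OG b -> OG (a + b).
Proof.
move=> [f _ <-] [h _ <-]; exists (fun x => f x + h x) => //.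
by rewrite -big_split; apply: eq_bigr => x _; rewrite tofracD scalerDl.
Qed.

Lemma OGZ (r : O) a : OG a -> OG (tofrac r *: a).
Proof.
move=> [f _ <-]; exists (fun x => r * f x) => //.
by rewrite scaler_sumr; apply: eq_bigr => x _; rewrite tofracM scalerA.
Qed.

Lemma OG1 : OG 1%:M.
Proof. by rewrite -(gelt1 O G); apply: OG_gelt. Qed.

Lemma OG_ind (S : M -> Prop) : S 0 -> (forall a b, S a -> S b -> S (a + b)) ->
  (forall (r : O) x, x \in G -> S (tofrac r *: gelt O G x)) ->
  forall a, OG a -> S a.
Proof.
by move=> S0 SD SZ a [f _ <-]; apply: (big_ind S) => // x Gx; apply: SZ.
Qed.

Lemma OGM a b : OG a -> OG b -> OG (a *m b).
Proof.
move=> OGa OGb; move: a OGa; apply: OG_ind.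
- by rewrite mul0mx; apply: OG0.
- by move=> a a' ? ?; rewrite mulmxDl; apply: OGD.
move=> r x Gx; move: b OGb; apply: OG_ind.
- by rewrite mulmx0; apply: OG0.
- by move=> a a' ? ?; rewrite mulmxDr; apply: OGD.
move=> s y Gy; rewrite -scalemxAl -scalemxAr -geltM //.
by apply/OGZ/OGZ/OG_gelt; rewrite groupM.
Qed.

Lemma OGJ x a : x \in G -> OG a -> OG (conj x a).
Proof. by move=> Gx Ca; do 2?apply: OGM => //; apply: OG_gelt; rewrite ?groupV. Qed.

Lemma OG_integral a : OG a -> exists a0 : 'M[O]_#|G|, map_mx (@tofrac O) a0 = a.
Proof.
move: a; apply: OG_ind.
- by exists 0; rewrite map_mx0.
- by move=> a b [a0 <-] [b0 <-]; exists (a0 + b0); rewrite map_mxD.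
move=> r x Gx; exists (r *: regular_mx O G x).
by rewrite map_mxZ map_regular_mx.
Qed.

Lemma OG_KG a : OG a -> KG a.
Proof.
move: a; apply: OG_ind; first exact: mem0mx.
  by move=> a b; rewrite /KG /= linearD; apply: addmx_sub.
by move=> r x Gx; rewrite /KG /= linearZ; apply/scalemx_sub/envelop_mx_id.
Qed.

Lemma fixed_commute_KG z a : fixed_by G z -> KG a -> z *m a = a *m z.
Proof.
move=> Fz /envelop_mxP[f ->]; rewrite mulmx_sumr mulmx_suml.
apply: eq_bigr => x Gx; rewrite -scalemxAr -scalemxAl; congr (_ *: _).
by apply/esym/commute_conj => //; apply: Fz.
Qed.

Lemma fixed_commute z a : fixed_by G z -> OG a -> z *m a = a *m z.
Proof. by move=> Fz OGa; apply: fixed_commute_KG Fz (OG_KG OGa). Qed.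

Lemma center_OGP z : center_of OG z <-> OG z /\ fixed_by G z.
Proof.
split=> [[OGz cz] | [OGz Fz]]; split=> //.
  by move=> x Gx; apply: conj_commute => //; rewrite cz //; apply: OG_gelt.
by move=> a OGa; apply: fixed_commute.
Qed.

Lemma center_KGP z : center_of KG z <-> KG z /\ fixed_by G z.
Proof.
split=> [[KGz cz] | [KGz Fz]]; split=> //.
  by move=> x Gx; apply: conj_commute => //; rewrite cz //; apply/OG_KG/OG_gelt.
by move=> a OGa; apply: fixed_commute_KG.
Qed.

Lemma OG_cut_order e : e *m e = e -> fixed_by G e -> order_in (OG_cut e) e.
Proof.
move=> ee Fe; have ce := fixed_commute Fe; split.
- by exists 1%:M; [apply: OG1 | rewrite mul1mx].
- by move=> _ _ [a OGa <-] [b OGb <-]; exists (a + b); [apply: OGD | rewrite mulmxDl].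
- move=> _ _ [a OGa <-] [b OGb <-]; exists (a *m b); first exact: OGM.
  by rewrite -!mulmxA (mulmxA e) ce // -mulmxA ee.
- by move=> r _ [a OGa <-]; exists (tofrac r *: a); [apply: OGZ | rewrite scalemxAl].
- by move=> _ [a OGa <-]; rewrite mulmxA ce // -mulmxA ee.
- by move=> _ [a OGa <-]; rewrite -mulmxA ee.
by move=> _ [a OGa <-]; have [a0 E] := OG_integral OGa; exists a0; rewrite E ce.
Qed.

Lemma OG_cut_stable e : fixed_by G e -> stable_under G (OG_cut e).
Proof.
move=> Fe x _ Gx [a OGa <-]; exists (conj x a); first exact: OGJ.
by rewrite conjM // Fe.
Qed.

Lemma OG_cut_sub e a : OG e -> OG_cut e a -> OG a.
Proof. by move=> OGe [a' OGa <-]; apply: OGM. Qed.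

Lemma source_cutP b i e w : OG b -> OG_cut b i -> i *m b = i -> b *m i = i ->
  source_cut b i e w <-> exists2 a, OG a & w = i *m a *m i *m e.
Proof.
move=> OGb Bi ib bi; split=> [[_ [_ [a OGa <-] <-] <-] | [a OGa ->]].
  by exists (a *m b) => //; apply: OGM.
exists (i *m a *m i) => //; exists (a *m b); first by exists a.
by rewrite -!mulmxA bi.
Qed.

Lemma source_cut_order b i e D : OG b -> OG_cut b i -> i *m b = i -> b *m i = i ->
  i *m i = i -> e *m e = e -> fixed_by G e -> D \subset G -> fixed_by D i ->
  [/\ order_in (source_cut b i e) (i *m e), fixed_by D (i *m e) &
      stable_under D (source_cut b i e)].
Proof.
move=> OGb Bi ib bi ii ee Fe sDG Fi; have ce := fixed_commute Fe.
have cutP w := source_cutP e w OGb Bi ib bi.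
have OGi := OG_cut_sub OGb Bi; have cei := ce i OGi.
have iee : i *m e *m (i *m e) = i *m e.
  by rewrite mulmxA -(mulmxA i e) cei mulmxA ii -mulmxA ee.
split; last 1 first.
- move=> x w Dx /cutP[a OGa ->]; apply/cutP; have Gx := subsetP sDG x Dx.
  by exists (conj x a); [apply: OGJ | rewrite !conjM // Fi // Fe].
- split.
  + by apply/cutP; exists 1%:M; [apply: OG1 | rewrite mulmx1 ii].
  + move=> _ _ /cutP[a OGa ->] /cutP[a' OGa' ->]; apply/cutP.
    by exists (a + a'); [apply: OGD | rewrite mulmxDr !mulmxDl].
  + move=> _ _ /cutP[a OGa ->] /cutP[a' OGa' ->]; apply/cutP.
    exists (a *m i *m a'); first by do 2?apply: OGM.
    have OGx : OG (i *m a' *m i) by do 2?apply: OGM.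
    rewrite -(mulmxA _ e) (mulmxA e) ce // -(mulmxA _ e e) ee !mulmxA.
    by rewrite -(mulmxA (i *m a) i i) ii.
  + move=> r _ /cutP[a OGa ->]; apply/cutP; exists (tofrac r *: a); first exact: OGZ.
    by rewrite -scalemxAr -!scalemxAl.
  + move=> _ /cutP[a OGa ->]; have OGx : OG (i *m a *m i) by do 2?apply: OGM.
    by rewrite -(mulmxA i e) (mulmxA e) ce // -(mulmxA _ e e) ee !mulmxA ii.
  + move=> _ /cutP[a OGa ->].
    by rewrite -(mulmxA _ e) (mulmxA e) cei -(mulmxA i e) ee mulmxA -(mulmxA _ i i) ii.
  + move=> _ /cutP[a OGa ->]; have OGx : OG (i *m a *m i) by do 2?apply: OGM.
    have [x0 E] := OG_integral OGx; exists x0; rewrite E; split.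
      by rewrite mulmxA -(mulmxA _ i i) ii.
    by rewrite -(mulmxA i e) ce // !mulmxA ii.
by apply: fixed_byM => //; apply: fixed_byS Fe.
Qed.

(** * Corners and primitive idempotents *)

Definition corner C i : set M := [set a | [/\ C a, i *m a = a & a *m i = a]]%classic.

Lemma corner_order C u i : order_in C u -> (forall a, C a -> OG a) -> C i ->
  i *m i = i -> order_in (corner C i) i.
Proof.
move=> oC COG Ci ii; split.
- by split.
- move=> a a' [Ca E1 E2] [Ca' E1' E2'].
  by split; [apply: (orderD oC) | rewrite mulmxDr E1 E1' | rewrite mulmxDl E2 E2'].
- move=> a a' [Ca E1 E2] [Ca' E1' E2'].
  by split; [apply: (orderM oC) | rewrite mulmxA E1 | rewrite -mulmxA E2'].
- move=> r a [Ca E1 E2].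
  by split; [apply: (orderZ oC) | rewrite -scalemxAr E1 | rewrite -scalemxAl E2].
- by move=> a [].
- by move=> a [].
by move=> a [Ca E1 E2]; have [a0 E] := OG_integral (COG a Ca); exists a0; rewrite E.
Qed.

Lemma primitive_idem_sub C i a : primitive_idem C i -> C a -> C (i - a) ->
  a *m a = a -> i *m a = a -> a *m i = a -> a = 0 \/ a = i.
Proof.
move=> [_ ii _ prim] Ca Cia aa ia ai.
have iaia : (i - a) *m (i - a) = i - a by rewrite mulmxBr !mulmxBl ii ia ai aa subrr subr0.
have aia : a *m (i - a) = 0 by rewrite mulmxBr ai aa subrr.
have iaa : (i - a) *m a = 0 by rewrite mulmxBl ia aa subrr.
have Ei : i = a + (i - a) by rewrite addrC subrK.
have [->|/eqP] := prim a (i - a) Ca Cia aa iaia aia iaa Ei; first by left.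
by rewrite subr_eq0 => /eqP->; right.
Qed.

(** C' may be much smaller than C: (OGe)^G is local because e is primitive in Z(KG), which is not an
    order over O. *)
Lemma primitive_local_order C C' i : primitive_idem C i -> order_in C' i ->
  (forall a, C' a -> C a) -> local_order C' i.
Proof.
move=> prim oC' sC; split=> //; first by case: prim.
move=> a C'a aa; apply: (primitive_idem_sub prim) => //.
- exact: sC.
- by apply/sC/(orderB oC') => //; apply: order1 oC'.
- exact: (order1l oC' C'a).
- exact: (order1r oC' C'a).
Qed.

End GroupOrders.

(** * Source idempotents and anchors *)

(** With r = i c j and s = j y one has r s = i, and t = s r is the idempotent under j associate to
    i; conversely i = r t s. *)
Lemma factor_idem (R : pzRingType) n (i c j y : 'M[R]_n) :
  i *m i = i -> j *m j = j -> i *m c *m j *m y = i ->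
  exists2 t, t = j *m y *m i *m c *m j &
    [/\ t *m t = t, j *m t = t, t *m j = t & t = 0 -> i = 0].
Proof.
move=> ii jj E; exists (j *m y *m i *m c *m j) => //; split.
- transitivity (j *m y *m (i *m c *m (j *m j) *m y) *m i *m c *m j).
    by rewrite !mulmxA.
  by rewrite jj E -(mulmxA _ i i) ii.
- by rewrite !mulmxA jj.
- by rewrite -mulmxA jj.
move=> t0; rewrite -ii -{1 2}E.
transitivity (i *m c *m (j *m y *m i *m c *m j) *m y); first by rewrite !mulmxA.
by rewrite t0 mulmx0 mul0mx.
Qed.

Lemma min_witness (T : Type) (m : T -> nat) (S : T -> Prop) :
  (exists t, S t) -> exists2 t, S t & forall t', S t' -> (m t <= m t')%N.
Proof.
move=> [t0 St0]; pose A n := `[< exists2 t, S t & m t = n >].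
have exA : exists n, A n by exists (m t0); apply/asboolP; exists t0.
case: (ex_minnP exA) => n /asboolP[t St <-] minn; exists t => // t' St'.
by apply: minn; apply/asboolP; exists t'.
Qed.

Section SourceIdempotent.
Variables (O : idomainType) (hO : complete_dvr O).
Variables (k : fieldType) (red : {rmorphism O -> k}) (hred : is_residue_map red).
Variables (gT : finGroupType) (G : {group gT}).
Local Notation K := {fraction O}.
Local Notation M := 'M[K]_#|G|.
Hypothesis hK : [pchar K] =i pred0.

Local Notation conj := (@conj_by O gT G).
Local Notation OG := (@OG O gT G).
Local Notation KG := (@KG O gT G).

Variables (b : M) (hb : is_block_idem b).
Local Notation B := (OG_cut b).

Let OGb : OG b. Proof. by case: hb => /center_OGP[]. Qed.
Let Fb : fixed_by G b. Proof. by case: hb => /center_OGP[]. Qed.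
Let bb : b *m b = b. Proof. by case: hb. Qed.
Let oB : order_in B b. Proof. exact: OG_cut_order. Qed.
Let sB : stable_under G B. Proof. exact: OG_cut_stable. Qed.

Lemma block_center_local : local_order (fixed B G) b.
Proof.
apply: (primitive_local_order hb); first exact: (fixed_order oB _ Fb).
by move=> a [Ba Fa]; apply/center_OGP; split=> //; apply: (OG_cut_sub OGb Ba).
Qed.

(** Among idempotents j with b in Tr(B^D j), one of least rank is chosen; minimality yields
    primitivity, and no decomposition of b into primitive idempotents has to be constructed. *)
Lemma primitive_trace_idem (D : {group gT}) : D \subset G ->
  (rel_trace D G @` fixed B D)%classic b ->
  exists j c, [/\ primitive_idem (fixed B D) j, fixed B D c &
    b = rel_trace D G (c *m j)].
Proof.
move=> sDG [c0 Bc0 Eb].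
have sBD : stable_under D B by move=> x a Dx; apply/sB/(subsetP sDG).
have oF : order_in (fixed B D) b by apply: (fixed_order oB sDG (fixed_byS sDG Fb)).
pose S (t : M * M) := [/\ fixed B D t.1, t.1 *m t.1 = t.1, fixed B D t.2 &
  b = rel_trace D G (t.2 *m t.1)].
have [|[j c] [/= Bj jj Bc Ec] minj] := @min_witness _ (fun t => \rank t.1) S.
  exists (b, c0); split=> //=; first exact: (order1 oF).
  by rewrite (order1r oF Bc0) Eb.
have nzb : b <> 0 by case: hb.
have FT a : fixed B D a -> fixed B G (rel_trace D G (c *m a)).
  move=> Ba; apply: (fixed_rel_trace hK oB sB sDG (subxx G) _).
  exact: (fixedM oB sDG Bc Ba).
(* If j = j1 + j2, then one of the two summands of the trace is a unit of Z(B),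
   and minimality of rank j leaves no room for the other idempotent. *)
have half (j1 j2 : M) : fixed B D j1 -> j1 *m j1 = j1 -> j1 *m j2 = 0 ->
    j2 *m j1 = 0 -> j = j1 + j2 -> j2 *m j2 = j2 ->
    unit_in (fixed B G) b (rel_trace D G (c *m j1)) -> j2 = 0.
  move=> Bj1 jj1 j12 j21 Ej jj2 [y [By Ty _]]; have [By' Fy] := By.
  have ByD := fixedW sDG By.
  have OGj1 : OG j1 by case: Bj1 => Bj1 _; apply: (OG_cut_sub OGb Bj1).
  have le_j : (\rank j <= \rank j1)%N.
    apply: (minj (j1, c *m y)); split=> //=; first exact: (fixedM oB sDG Bc ByD).
    rewrite -Ty rel_trace_mulr //; congr (rel_trace D G _).
    by rewrite -!mulmxA (fixed_commute Fy).
  (* From j1 = j1 j the row space of j1 lies in that of j. Equal ranks give j = w j1, so j2 = j j2 =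
     w j1 j2 = 0. *)
  have sj1 : (j1 <= j)%MS.
    by apply/submxP; exists j1; rewrite Ej mulmxDr jj1 j12 addr0.
  have /submxP[w Ew] : (j <= j1)%MS.
    have [le1 <-] := mxrank_leqif_sup sj1; by rewrite eqn_leq le1 le_j.
  have <- : j *m j2 = j2 by rewrite Ej mulmxDl j12 add0r.
  by rewrite Ew -mulmxA j12 mulmx0.
exists j, c; split=> //; split=> //.
  move=> j0; apply: nzb; rewrite Ec j0 mulmx0.
  by have := rel_traceZ D G 0 (0 : M); rewrite !scale0r.
move=> j1 j2 Bj1 Bj2 jj1 jj2 j12 j21 Ej.
have [||t] := local_order_unit_sum hO hred (s := [:: j1; j2])
    (F := fun a => rel_trace D G (c *m a)) block_center_local.
- by move=> a; rewrite !inE => /orP[] /eqP->; apply: FT.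
- rewrite big_cons big_seq1 -rel_traceD -mulmxDr -Ej -Ec.
  by exists b; split=> //; apply: (order1 (fixed_order oB (subxx G) Fb)).
rewrite !inE => /orP[] /eqP-> Ut; [right | left].
  exact: (half _ _ Bj1 jj1 j12 j21 Ej jj2 Ut).
by apply: (half _ _ Bj2 jj2 j21 j12 _ jj1 Ut); rewrite addrC.
Qed.

Variables (D : {group gT}) (hD : defect_group b D).
Variables (i : M) (hi : source_idem b D i).

Let sDG : D \subset G. Proof. by case: hD. Qed.
Let Bi : fixed B D i. Proof. by case: hi => -[]. Qed.
Let ii : i *m i = i. Proof. by case: hi => -[]. Qed.
Let sBD : stable_under D B.
Proof. by move=> x a Dx; apply/sB/(subsetP sDG). Qed.
Let oF : order_in (fixed B D) b.
Proof. exact: (fixed_order oB sDG (fixed_byS sDG Fb)). Qed.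
Let ib : i *m b = i. Proof. exact: (order1r oF Bi). Qed.
Let bi : b *m i = i. Proof. exact: (order1l oF Bi). Qed.
Let nki : ~ brauer_ker B D i.
Proof. by case: hi => _ nE /(brauer_map_eq0 _ _ oB). Qed.

Lemma source_corner_local : local_order (corner (fixed B D) i) i.
Proof.
case: hi => prim _; apply: (primitive_local_order prim); last by move=> a [].
apply: (corner_order oF _ Bi ii).
by move=> a [Ba _]; apply: (OG_cut_sub OGb Ba).
Qed.

(** Up to conjugation by an element normalizing D, the idempotent j is associate to i; hence a
    single product w i v suffices instead of a sum of such products. *)
Lemma block_trace_source : exists w v, [/\ fixed B D w, fixed B D v &
  b = rel_trace D G (w *m i *m v)].
Proof.
have [_ Db _] := hD.
have [j [c [prim_j Bc Ec]]] := primitive_trace_idem sDG Db.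
have [Bj jj _ _] := prim_j.
have Bcj := fixedM oB sDG Bc Bj.
have [s [sG Es]] := mackey hK sDG sDG (proj2 Bcj).
pose T x := rel_trace (D :&: D :^ x^-1) D (conj x (c *m j)).
have FT x : x \in G -> fixed B D (T x).
  move=> Gx; apply: (fixed_rel_trace hK oB sBD (subsetIl _ _) sDG _) => //.
  exact: (fixedW (subsetIr _ _) (fixedJ sB sDG Gx Bcj)).
have WT x : x \in G -> corner (fixed B D) i (i *m T x *m i).
  move=> Gx; split; last by rewrite -mulmxA ii.
    by apply: (fixedM oB sDG _ Bi); apply: (fixedM oB sDG Bi (FT x Gx)).
  by rewrite !mulmxA ii.
have [||x sx [y [[By iy yi] Ey _]]] := local_order_unit_sum hO hred (s := s)
    (F := fun x => i *m T x *m i) source_corner_local.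
- by move=> x /sG/WT.
- rewrite -mulmx_suml -mulmx_sumr -Es -Ec ib ii.
  by exists i; split=> //; split.
have Gx := sG x sx.
(* [i *m T x *m i] is a unit of the corner, so [T x] in the ideal would bring i into it. *)
have kTx : ~ brauer_ker B D (T x).
  move=> kT; apply: nki; rewrite -Ey.
  have [_] := brauer_kerM oB sDG By (brauer_kerM oB sDG Bi
    (brauer_kerM oB sDG Bi kT).1).2.
  by [].
(* Otherwise [T x] would be a trace from a proper subgroup of D. Comparing orders, x normalizes D,
   and [T x] is just the conjugate of c j. *)
have sDDx : D \subset D :^ x^-1.
  apply/setIidPl/eqP; rewrite eqEproper subsetIl; apply/negP => pDD.
  apply: kTx; apply: brauer_ker_trace => //.
  exact: (fixedW (subsetIr _ _) (fixedJ sB sDG Gx Bcj)).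
have EDx : (D :^ x^-1)%G = D.
  by apply/val_inj/esym/eqP; rewrite eqEcard sDDx cardJg leqnn.
have EGx : (G :^ x^-1)%G = G by apply/val_inj; rewrite /= conjGid ?groupV.
have EDI : (D :&: D :^ x^-1)%G = D by apply/val_inj/setIidPl.
have BJ a : fixed B D a -> fixed B D (conj x a).
  by move=> Ba; rewrite -EDx; apply: fixedJ.
have ETx : T x = conj x c *m conj x j.
  rewrite /T [X in rel_trace X]EDI rel_trace_id // ?conjM //.
  by have [_] := BJ _ Bcj; rewrite conjM.
have [[c1 Ec1] [j1 Ej1]] : (exists c1, c1 = conj x c) /\ (exists j1, j1 = conj x j).
  by split; eexists.
have [Bc1 Bj1] : fixed B D c1 /\ fixed B D j1 by rewrite Ec1 Ej1; split; apply: BJ.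
have jj1 : j1 *m j1 = j1 by rewrite Ej1 -conjM // jj.
have Ei : i *m c1 *m j1 *m y = i.
  by rewrite -[RHS]Ey ETx -Ec1 -Ej1 -[in RHS]mulmxA iy !mulmxA.
have [t Et [tt j1t tj1 nzt]] := factor_idem ii jj1 Ei.
have Bt : fixed B D t.
  rewrite Et; apply: (fixedM oB sDG _ Bj1); apply: (fixedM oB sDG _ Bc1).
  by apply: (fixedM oB sDG _ Bi); apply: (fixedM oB sDG Bj1 By).
have Etj : t = j1.
  (* Conjugated back, t becomes a nonzero idempotent of j B^D j, which must be the primitive j
     itself. *)
  pose t' := conj x^-1%g t.
  have Ext : conj x t' = t by rewrite conjKVg.
  have Bt' : fixed B D t'.
    have EDV : (D :^ x^-1^-1)%G = D.
      by apply/val_inj; rewrite /= invgK -{1}EDx /= conjsgKV.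
    by rewrite -EDV; apply: fixedJ => //; rewrite groupV.
  have jt' : j *m t' = t'.
    by rewrite -[j](conjKg _ Gx) -Ej1 -conjM ?groupV // j1t.
  have t'j : t' *m j = t'.
    by rewrite -[j](conjKg _ Gx) -Ej1 -conjM ?groupV // tj1.
  have t't' : t' *m t' = t' by rewrite -conjM ?groupV // tt.
  have [t'0|Et'] := primitive_idem_sub prim_j Bt' (orderB oF Bj Bt') t't' jt' t'j.
    case: hi => -[_ _ nzi _] _; case: nzi; apply: nzt.
    by rewrite -Ext t'0 conj0.
  by rewrite -Ext Et' Ej1.
(* The product w i v is c1 (j1 y i c1 j1) = c1 t = c1 j1, the conjugate of c j by x, whose trace is
   again b. *)
exists (c1 *m j1 *m y), (c1 *m j1); split.
- by do !apply: (fixedM oB sDG).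
- by do !apply: (fixedM oB sDG).
have -> : c1 *m j1 *m y *m i *m (c1 *m j1) = conj x (c *m j).
  by rewrite (conjM _ _ Gx) -Ec1 -Ej1 -[in RHS]Etj Et !mulmxA.
have := rel_traceJ hK sDG (subxx G) Gx (proj2 Bcj).
by rewrite EDx EGx -Ec (Fb Gx).
Qed.

(** * From the block to the orders cut by the character idempotent *)

Variables (e : M) (KGe : KG e) (ee : e *m e = e) (Fe : fixed_by G e).
Hypothesis be : b *m e = e.
Local Notation C := (OG_cut e).
Local Notation sC := (source_cut b i e).

Let oC : order_in C e. Proof. exact: OG_cut_order. Qed.
Let stC : stable_under G C. Proof. exact: OG_cut_stable. Qed.
Let ce a : OG a -> e *m a = a *m e. Proof. exact: fixed_commute. Qed.
Let OGi : OG i. Proof. by case: Bi => + _; exact: (OG_cut_sub OGb). Qed.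

Let source_order : [/\ order_in sC (i *m e), fixed_by D (i *m e) & stable_under D sC].
Proof. by case: Bi => Bi' Fi; apply: source_cut_order. Qed.

Lemma block_cutE : block_cut b e = C.
Proof.
apply/predeqP => z; split=> [[_ [a OGa <-] <-] | [a OGa <-]].
  by exists a => //; rewrite -mulmxA be.
by exists (a *m b); [exists a | rewrite -mulmxA be].
Qed.

Lemma source_brauer_conj (Q : {group gT}) : Q \subset G ->
  brauer_nonzero (block_cut b e) Q ->
  exists x, [/\ x \in G, (Q :^ x^-1)%g \subset D & brauer_nonzero sC (Q :^ x^-1)%G].
Proof.
move=> sQG; rewrite block_cutE.
move=> /(brauer_nonzeroP oC sQG (fixed_byS sQG Fe)) nke.
have [w [v [Bw Bv Eb]]] := block_trace_source.
pose a := w *m i *m v *m e.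
have Ce z : fixed B D z -> fixed C D (z *m e).
  move=> [Bz Fz]; split; first by exists z => //; apply: (OG_cut_sub OGb Bz).
  by apply: fixed_byM => //; apply: (fixed_byS _ Fe).
have Ca : fixed C D a by apply: Ce; do !apply: (fixedM oB sDG).
have Ee : e = rel_trace D G a by rewrite -{1}be Eb rel_trace_mulr.
have nka : ~ brauer_ker C Q (rel_trace D G a) by rewrite -Ee.
have [x [Gx sQD nkx]] := brauer_ker_rel_trace hK oC stC sQG sDG Ca nka.
have GV : x^-1%g \in G by rewrite groupV.
have sQxD : (Q :^ x^-1^-1)%g \subset D by rewrite invgK sub_conjg.
(* Mackey's formula gives Q inside xDx^-1, so the conjugate lying in D is the one by x^-1. *)
exists x^-1%g; split=> //.
have [oS FS _] := source_order.
have sQxG := subset_trans sQxD sDG.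
apply/(brauer_nonzeroP oS sQxG (fixed_byS sQxD FS)) => kie.
apply: nkx.
have -> : Q = ((Q :^ x^-1^-1) :^ x^-1)%G by apply/val_inj; rewrite /= invgK conjsgK.
apply: brauer_kerJ => //.
(* A e_chi lies in OGe_chi, so the kernel for the former is contained in that for the latter, an
   ideal; multiplying i e by w e and v e then yields a = w i v e. *)
have kie' : brauer_ker C (Q :^ x^-1^-1)%G (i *m e).
  apply: (brauer_kerS _ kie) => z.
  case: (Bi) => Bi' _ /(source_cutP e z OGb Bi' ib bi)[z' OGz ->].
  by exists (i *m z' *m i) => //; do 2?apply: OGM.
have Cw := fixedW sQxD (Ce _ Bw); have Cv := fixedW sQxD (Ce _ Bv).
have [+ _] := brauer_kerM oC sQxG Cw kie'.
move=> /(brauer_kerM oC sQxG Cv)[_].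
have OGv : OG v by case: Bv => + _; exact: (OG_cut_sub OGb).
suff -> : w *m e *m (i *m e) *m (v *m e) = a by [].
rewrite -(mulmxA w) (mulmxA e) ce // -(mulmxA i e e) ee !mulmxA.
by rewrite -(mulmxA _ e v) ce // !mulmxA -(mulmxA _ e e) ee.
Qed.

Hypothesis prime_e : primitive_idem (center_of KG) e.

Let loZ : local_order (fixed C G) e.
Proof.
apply: (primitive_local_order prime_e); first exact: (fixed_order oC _ Fe).
move=> a [[a' OGa <-] Fa]; apply/center_KGP; split=> //.
exact: (envelop_mxM (OG_KG OGa) KGe).
Qed.

(** For a in the Brauer kernel, Tr_P^G(c a) is a nonunit of the local ring (OGe)^G. This is checked
    on generators: traces from proper subgroups are excluded by minimality of P, multiples by J(O)
    lie in the radical, and nonunits add up to nonunits. For a = e the trace is the unit e. *)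
Lemma min_trace_brauer (P : {group gT}) c : P \subset G -> fixed C P c ->
  e = rel_trace P G c ->
  (forall (R : {group gT}) c', R \proper P -> fixed C R c' -> e <> rel_trace R G c') ->
  ~ brauer_ker C P e.
Proof.
move=> sPG Cc Ec minP ke.
have [oZ nze _] := loZ.
have Ce : fixed C P e by split; [apply: (order1 oC) | apply: (fixed_byS _ Fe)].
have FT a : fixed C P a -> fixed C G (rel_trace P G (c *m a)).
  by move=> Ca; apply: (fixed_rel_trace hK oC stC sPG (subxx G) (fixedM oC sPG Cc Ca)).
suff nU a : brauer_ker C P a -> fixed C G (rel_trace P G (c *m a)) /\
    ~ unit_in (fixed C G) e (rel_trace P G (c *m a)).
  have [_] := nU e ke; rewrite (order1r oC) -?Ec; last by case: Cc.
  by case; exists e; split; rewrite ?ee //; apply: (order1 oZ).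
move: a; apply: brauer_ker_ind.
- have -> : rel_trace P G (c *m 0) = 0 :> M.
    by rewrite mulmx0; have := rel_traceZ P G 0 (0 : M); rewrite !scale0r.
  split; first exact: (order0 oZ).
  by move=> [y [_ E _]]; apply: nze; rewrite -E mul0mx.
- move=> a1 a2 [C1 n1] [C2 n2]; rewrite mulmxDr rel_traceD.
  split; first exact: (orderD oZ).
  move=> U; have [||t] := local_order_unit_sum hO hred (s := [:: a1; a2])
     (F := fun a => rel_trace P G (c *m a)) loZ.
  + by move=> a; rewrite !inE => /orP[] /eqP->.
  + by rewrite big_cons big_seq1.
  by rewrite !inE => /orP[] /eqP->.
- move=> R a pRP Ca; have sRP := proper_sub pRP.
  have sRG := subset_trans sRP sPG; have CcR := fixedW sRP Cc.
  have Cca := fixedM oC sRG CcR Ca.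
  rewrite rel_trace_mull //; last by case: Cc.
  rewrite rel_trace_trans //; last by case: Cca.
  split; first exact: (fixed_rel_trace hK oC stC sRG (subxx G) Cca).
  (* An inverse y is fixed by G and can be moved inside the trace, giving e as a trace from the
     proper subgroup R. *)
  move=> [y [Cy Ey _]]; apply: (minP R (c *m a *m y)) => //.
    by apply: (fixedM oC sRG Cca (fixedW sRG Cy)).
  by rewrite -Ey rel_trace_mulr //; case: Cy.
move=> r a mr Ca; rewrite -scalemxAr rel_traceZ.
have CT := FT a Ca; split; first exact: (fixedZ _ oC CT).
move=> [y [Cy Ey _]].
have [z [_ Ez _]] := unit_in_sub_nonunit hO oZ (fixedM oC (subxx G) CT Cy) mr.
by apply: nze; rewrite -Ez scalemxAl Ey subrr mul0mx.
Qed.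

Lemma max_source_anchor (Q : {group gT}) : Q \subset D ->
  brauer_nonzero sC Q ->
  (forall R : {group gT}, R \subset D -> brauer_nonzero sC R -> (#|R| <= #|Q|)%N) ->
  anchor e Q.
Proof.
move=> sQD; have sQG := subset_trans sQD sDG; have [oS FS _] := source_order.
move=> /(brauer_nonzeroP oS sQG (fixed_byS sQD FS)) nkS maxQ.
have nkQ : ~ brauer_ker C Q e.
  move=> ke; apply: nkS; have [Bi' Fi] := Bi.
  (* The map z to i z i carries OGe to A e_chi and e to the identity i e, hence Brauer kernel to
     Brauer kernel. *)
  have -> : i *m e = i *m e *m i by rewrite -mulmxA ce // mulmxA ii.
  apply: (brauer_ker_sandwich _ _ _ ke) => //; first exact: (fixed_byS _ Fi).
  move=> _ [a OGa <-]; apply/(source_cutP e _ OGb Bi' ib bi); exists a => //.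
  by rewrite -!mulmxA ce.
(* Used twice: to embed Q in a conjugate of P, and at the end to exclude proper subgroups of Q. *)
have trQ (P : {group gT}) c : P \subset G -> fixed C P c -> e = rel_trace P G c ->
    exists2 x, x \in G & Q \subset P :^ x^-1.
  move=> sPG Cc Ec; have nk : ~ brauer_ker C Q (rel_trace P G c) by rewrite -Ec.
  by have [x []] := brauer_ker_rel_trace hK oC stC sQG sPG Cc nk; exists x.
(* P is taken of least order, which implies minimality under inclusion; the pair (G, e) shows that
   there is a candidate. *)
pose S (t : {group gT} * M) := [/\ t.1 \subset G, fixed C t.1 t.2 & e = rel_trace t.1 G t.2].
have [|[P c] /= [sPG Cc Ec] minP] := @min_witness _ (fun t : {group gT} * M => #|t.1|) S.
  exists (G, e); split=> //=; first by split=> //; apply: (order1 oC).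
  by rewrite rel_trace_id.
have [x Gx sQP] := trQ P c sPG Cc Ec.
have nkP : ~ brauer_ker C P e.
  apply: (min_trace_brauer sPG Cc Ec _) => // R c' pRP Cc' E.
  have sRG := subset_trans (proper_sub pRP) sPG.
  by have := minP (R, c') (And3 sRG Cc' E); rewrite /= leqNgt proper_card.
have [y [Gy sPD nzP]] : exists x, [/\ x \in G, (P :^ x^-1)%g \subset D &
    brauer_nonzero sC (P :^ x^-1)%G].
  apply: source_brauer_conj => //; rewrite block_cutE.
  by apply/(brauer_nonzeroP oC sPG (fixed_byS sPG Fe)).
have lePQ : (#|P| <= #|Q|)%N.
  by have := maxQ _ sPD nzP; rewrite cardJg.
have EQ : Q = (P :^ x^-1)%G.
  by apply/val_inj/eqP; rewrite eqEcard sQP cardJg.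
split=> //.
  exists (conj x c); first by rewrite EQ; apply: fixedJ.
  rewrite [in RHS]Ec -[RHS](_ : conj x (rel_trace P G c) = _); last by rewrite -Ec Fe.
  rewrite rel_traceJ //; last by case: Cc.
  have EGx : (G :^ x^-1)%G = G by apply/val_inj; rewrite /= conjGid ?groupV.
  by rewrite EQ [in RHS]EGx.
move=> R pRQ [c' Cc' Ec'].
have sRG := subset_trans (proper_sub pRQ) sQG.
have [z Gz sQR] := trQ R c' sRG Cc' (esym Ec').
have := subset_leq_card sQR; rewrite cardJg leqNgt.
by rewrite proper_card.
Qed.

End SourceIdempotent.

(** By primitivity of e in Z(KG), be is 0 or e. Since chi(b) = chi(1) is nonzero in characteristic
    0, b acts on the simple module by a nonzero endomorphism, invertible by Schur's lemma. If be =
    0, then e acts as 0, against chi(e) <> 0. *)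
Lemma block_mul_char_idem (O : idomainType) (gT : finGroupType) (G : {group gT})
    (b e : 'M[{fraction O}]_#|G|) (chi : 'M[{fraction O}]_#|G| -> {fraction O}) :
  [pchar {fraction O}] =i pred0 ->
  is_block_idem b -> irr_block b chi -> char_idem chi e -> b *m e = e.
Proof.
move=> hK [/center_OGP[OGb Fb] bb _ _] [[n [rG [irr Echi]]] chib] [prime_e chie].
have [/center_KGP[KGe Fe] ee _ _] := prime_e; have KGb := OG_KG OGb.
have KGbe : KG (b *m e) := envelop_mxM KGb KGe.
have Fbe : fixed_by G (b *m e) by apply: fixed_byM.
have be_eb : e *m b = b *m e by apply: fixed_commute_KG.
have ebe : e *m (b *m e) = b *m e by rewrite mulmxA be_eb -mulmxA ee.
have [|||||be0|//] := primitive_idem_sub (a := b *m e) prime_e.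
- exact/center_KGP.
- apply/center_KGP; split.
    by rewrite /KG /= linearB; apply: addmx_sub; rewrite ?eqmx_opp.
  by apply: fixed_byD => //; rewrite -scaleN1r; apply: fixed_byZ.
- by rewrite -mulmxA ebe mulmxA bb.
- exact: ebe.
- by rewrite -mulmxA ee.
case: chie; rewrite Echi /=.
suff -> : gring_op rG e = 0 by rewrite mxtrace0.
have n_gt0 : (0 < n)%N by case/mx_irrP: irr.
have nz_rGb : gring_op rG b != 0.
  apply/eqP=> b0; move: chib; rewrite Echi b0 mxtrace0 gring_op1 mxtrace1 => /esym/eqP.
  by rewrite ((pcharf0P _).1 hK) -leqn0 leqNgt n_gt0.
have cent_rGb : centgmx rG (gring_op rG b).
  apply/centgmxP=> x Gx; have KGx : KG (gelt O G x) by apply/OG_KG/OG_gelt.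
  rewrite -(gring_opG rG Gx) -!gring_opM //; congr (gring_op rG _).
  exact: (fixed_commute Fb (OG_gelt O Gx)).
have Ub := mx_Schur irr cent_rGb nz_rGb.
by rewrite -[LHS](mulKmx Ub) -gring_opM // be0 linear0 mulmx0.
Qed.

Theorem theorem4p1
    (p : nat) (hp : prime p)
    (O : idomainType) (hO : complete_dvr O)
    (k : fieldType) (red : {rmorphism O -> k}) (hred : is_residue_map red)
    (hk : p \in [pchar k])
    (hK : [pchar {fraction O}] =i pred0)
    (gT : finGroupType) (G : {group gT})
    (hsplitK : splits_subgroups {fraction O} G)
    (hsplitk : splits_subgroups k G)
    (b : 'M[{fraction O}]_#|G|) (hb : is_block_idem b)
    (D : {group gT}) (hD : defect_group b D)
    (i : 'M[{fraction O}]_#|G|) (hi : source_idem b D i)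
    (chi : 'M[{fraction O}]_#|G| -> {fraction O}) (hchi : irr_block b chi)
    (e : 'M[{fraction O}]_#|G|) (he : char_idem chi e) :
  (forall Q : {group gT}, Q \subset G -> p.-group Q ->
     brauer_nonzero (block_cut b e) Q ->
     exists x, [/\ x \in G, (Q :^ x^-1)%g \subset D &
       brauer_nonzero (source_cut b i e) (Q :^ x^-1)%G])
  /\
  (forall Q : {group gT}, Q \subset D ->
     brauer_nonzero (source_cut b i e) Q ->
     (forall R : {group gT}, R \subset D ->
        brauer_nonzero (source_cut b i e) R -> (#|R| <= #|Q|)%N) ->
     anchor e Q).
Proof.
have be := block_mul_char_idem hK hb hchi he.
have [prime_e _] := he; have [/center_KGP[KGe Fe] ee _ _] := prime_e.
split=> [Q sQG _ nzQ | Q sQD nzQ maxQ].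
  exact: (source_brauer_conj hO hred hK hb hD hi ee Fe be sQG nzQ).
exact: (max_source_anchor hO hred hK hb hD hi KGe ee Fe be prime_e sQD nzQ maxQ).
Qed.
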